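(* Let $u$ be a weak solution in $\Omega$ such that $u\ge0$ in $\{x_2\ge x_2^0\}$, $\{u=0\}$ has locally only finitely many connected components, and $|\nabla u^-|\le|x_2-x_2^0|^{1/2}$ near the points of $\Sigma^u$. Then $\Sigma^u=\varnothing$.
   Context: Let $\Omega\subset\mathbb{R}^2$ be open and $x_2^0\in\mathbb{R}$ a constant. $u^+=\max\{u,0\}$, $u^-=\min\{u,0\}$, $\chi_A$ is the characteristic function of $A$. A weak solution is $u\in W^{1,2}(\Omega)$ with: (i) $u\in C(\Omega)\cap C^2(\Omega\cap\{u\ne0\})$; (ii) for every $\phi=(\phi_1,\phi_2)\in C^1_0(\Omega;\mathbb{R}^2)$, $0=\int_\Omega(|\nabla u|^2\mathrm{div}\phi-2\nabla u\,D\phi\,\nabla u)dx+\int_{\Omega\cap\{x_2<x_2^0\}}((x_2^0-x_2)\chi_{\{u<0\}}\mathrm{div}\phi-\chi_{\{u<0\}}\phi_2)dx+\int_{\Omega\cap\{x_2>x_2^0\}}((x_2-x_2^0)\chi_{\{u>0\}}\mathrm{div}\phi+\chi_{\{u>0\}}\phi_2)dx$; (iii) $\partial\{u<0\}\cap\Omega$ is locally a $C^{2,\alpha}$ curve. For $x\in\partial\{u<0\}$, $M_{x,u^-}(0^+)=\lim_{r\to0^+}\big(r^{-3}\int_{B_r(x)}(|\nabla u^-|^2+(x_2^0-y_2)^+\chi_{\{u<0\}})dy-\frac32r^{-4}\int_{\partial B_r(x)}(u^-)^2dS\big)$; $\Sigma^u$ is the set of $x\in\partial\{u<0\}$ with $x_2=x_2^0$,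 $|\nabla u^-(x)|=0$, $M_{x,u^-}(0^+)=\frac23$. *)

(* Defs.v *)
(* The plane R^2 is modelled as R * R (product
   topology = Euclidean topology), with Lebesgue measure mu2 := lambda \x lambda. *)
From HB Require Import structures.
From mathcomp Require Import all_boot all_order all_algebra.
From mathcomp Require Import all_classical all_reals all_analysis.
Set Implicit Arguments. Unset Strict Implicit. Unset Printing Implicit Defensive.
Import Order.TTheory GRing.Theory Num.Theory.
Import numFieldNormedType.Exports.
Local Open Scope classical_set_scope.
Local Open Scope ring_scope.

Section Plane.
Variable R : realType.

Definition pl := (R * R)%type.

Definition mu2 := ((@lebesgue_measure R) \x (@lebesgue_measure R))%E.

Definition e1 : pl := (1, 0).
Definition e2 : pl := (0, 1).
Definition d1 (f : pl -> R) (x : pl) : R := 'D_e1 f x.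
Definition d2 (f : pl -> R) (x : pl) : R := 'D_e2 f x.

Definition enorm (v : pl) : R := Num.sqrt (v.1 ^+ 2 + v.2 ^+ 2).
Definition eball (x : pl) (r : R) : set pl :=
  [set y | enorm (y.1 - x.1, y.2 - x.2) < r].

Definition bdry (A : set pl) : set pl := closure A `\` interior A.

Definition C1 (f : pl -> R) : Prop :=
  (forall x, derivable f x e1 /\ derivable f x e2) /\
  continuous f /\ continuous (d1 f) /\ continuous (d2 f).

Definition C1c (O : set pl) (f : pl -> R) : Prop :=
  C1 f /\ compact (closure [set x | f x != 0]) /\
  closure [set x | f x != 0] `<=` O.

Definition C2_on (U : set pl) (f : pl -> R) : Prop :=
  forall x, U x ->
    [/\ {for x, continuous f},
        derivable f x e1 /\ derivable f x e2,
        {for x, continuous (d1 f)} /\ {for x, continuous (d2 f)},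
        [/\ derivable (d1 f) x e1, derivable (d1 f) x e2,
            derivable (d2 f) x e1 & derivable (d2 f) x e2] &
        [/\ {for x, continuous (d1 (d1 f))}, {for x, continuous (d2 (d1 f))},
            {for x, continuous (d1 (d2 f))} & {for x, continuous (d2 (d2 f))}]].

Definition L2 (O : set pl) (f : pl -> R) : Prop :=
  measurable_fun O f /\ mu2.-integrable O (fun x => ((f x) ^+ 2)%:E).

Definition weak_grad (O : set pl) (u g1 g2 : pl -> R) : Prop :=
  forall phi, C1c O phi ->
    (\int[mu2]_(x in O) ((u x * d1 phi x)%R)%:E =
       - \int[mu2]_(x in O) ((g1 x * phi x)%R)%:E)%E /\
    (\int[mu2]_(x in O) ((u x * d2 phi x)%R)%:E =
       - \int[mu2]_(x in O) ((g2 x * phi x)%R)%:E)%E.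

Definition W12 (O : set pl) (u g1 g2 : pl -> R) : Prop :=
  [/\ L2 O u, L2 O g1, L2 O g2 & weak_grad O u g1 g2].

Definition chi (b : bool) : R := b%:R.

(* the domain-variation identity (ii), for phi = (p1, p2) *)
Definition weak_identity (O : set pl) (x20 : R) (u g1 g2 p1 p2 : pl -> R) : Prop :=
  let div x := d1 p1 x + d2 p2 x in
  let gDg x := g1 x * d1 p1 x * g1 x + g1 x * d2 p1 x * g2 x
             + g2 x * d1 p2 x * g1 x + g2 x * d2 p2 x * g2 x in
  (0 = \int[mu2]_(x in O)
          ((g1 x ^+ 2 + g2 x ^+ 2) * div x - 2 * gDg x)%R%:E
     + \int[mu2]_(x in O `&` [set y | (y.2 < x20)%R])
          ((x20 - x.2) * chi (u x < 0) * div x - chi (u x < 0) * p2 x)%R%:E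
     + \int[mu2]_(x in O `&` [set y | (y.2 > x20)%R])
          ((x.2 - x20) * chi (u x > 0) * div x + chi (u x > 0) * p2 x)%R%:E)%E.

(* "Gamma is locally a C^{2,alpha} curve": near each of its points in O it is,
   in suitably rotated coordinates, the graph of a C^{2,alpha} function *)
Definition loc_C2alpha_curve (O : set pl) (Gam : set pl) : Prop :=
  exists alpha : R, 0 < alpha <= 1 /\
  forall x, O x -> Gam x ->
    exists (r : R) (th : R) (f : R -> R) (C : R),
      [/\ 0 < r,
          forall s, `|s| < r -> derivable f s 1 /\ derivable (derive1 f) s 1,
          forall s s', `|s| < r -> `|s'| < r ->
             `|derive1 (derive1 f) s - derive1 (derive1 f) s'| <= C * powR `|s - s'| alpha &
          forall y, eball x r y ->
            (Gam y <->
               - sin th * (y.1 - x.1) + cos th * (y.2 - x.2)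
               = f (cos th * (y.1 - x.1) + sin th * (y.2 - x.2)))].

Definition weak_solution (O : set pl) (x20 : R) (u : pl -> R) : Prop :=
  exists g1 g2 : pl -> R,
  [/\ W12 O u g1 g2,
      (forall x, O x -> {for x, continuous u}),
      C2_on (O `&` [set x | u x != 0]) u,
      (forall p1 p2, C1c O p1 -> C1c O p2 -> weak_identity O x20 u g1 g2 p1 p2) &
      loc_C2alpha_curve O (bdry [set x | u x < 0] `&` O)].

(* pointwise gradient of u^- = min(u,0): grad u on {u<0}, 0 elsewhere *)
Definition gradm (u : pl -> R) (y : pl) : pl :=
  if u y < 0 then (d1 u y, d2 u y) else (0, 0).

Definition negpart (a : R) : R := Num.min a 0.
Definition pospart (a : R) : R := Num.max a 0.

(* the monotonicity-formula quantity M_{x,u^-}(r) *)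
Definition Mfun (x20 : R) (u : pl -> R) (x : pl) (r : R) : R :=
  r ^- 3 * Rintegral mu2 (eball x r)
     (fun y => enorm (gradm u y) ^+ 2 + pospart (x20 - y.2) * chi (u y < 0))
  - 3 / 2 * r ^- 4 * Rintegral (@lebesgue_measure R) `[0, 2 * pi]%classic
     (fun t => negpart (u (x.1 + r * cos t, x.2 + r * sin t)) ^+ 2 * r).

Definition Sigma (O : set pl) (x20 : R) (u : pl -> R) : set pl :=
  [set x | [/\ O x, bdry [set y | u y < 0] x, x.2 = x20,
              enorm (gradm u y) @[y --> x] --> (0:R) &
              Mfun x20 u x r @[r --> (0:R)^'+] --> (2 / 3 : R)]].

Definition loc_finite_zero_components (O : set pl) (u : pl -> R) : Prop :=
  let Z := O `&` [set y | u y = 0] in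
  forall x, O x -> exists r : R, 0 < r /\
    finite_set [set K | exists y, [/\ Z y, eball x r y & K = connected_component Z y]].

End Plane.

(* Main.v *)
(** Let [x] be a point of [Sigma].  By (iii) the boundary of {u < 0} is, near [x],
    the graph of a function with a quadratic Taylor bound, so one of its two
    sides lies in {u < 0}, and this side contains a disc [B] touching the
    boundary exactly at [x].

    Testing (ii) with fields supported in {u < 0}, which lies below the level
    [x20], gives |grad u|^2 Lap u = 0 there: the weak gradient agrees almost
    everywhere with the classical one, and the gravity term is a divergence.

    Hopf's boundary point argument only needs Lap u = 0 where grad u <> 0, since
    the barrier has no critical point in the annulus.  Hence [u] decreases at
    least linearly from [x] into [B], contradicting grad u^- -> 0 at [x]. *)
Require Import Defs.
From HB Require Import structures.
From mathcomp Require Import all_boot all_order all_algebra.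
From mathcomp Require Import all_classical all_reals all_analysis.
From mathcomp Require Import measurable_realfun ring lra.
Import Order.TTheory GRing.Theory Num.Theory.
Import numFieldNormedType.Exports.
Local Open Scope classical_set_scope.
Local Open Scope ring_scope.
Set Implicit Arguments. Unset Strict Implicit. Unset Printing Implicit Defensive.

(** A domain variation along (al, be) phi pairs (al, be) with the divergence of the stress tensor
    |grad u|^2 I - 2 grad u tensor grad u, which is -2 (Lap u) grad u. Critical points of [u] are
    invisible to it; this is why the equation carries the factor |grad u|^2. Test fields are
    constant vectors times C^1 bumps on boxes, because on a box integration by parts is Fubini plus
    the one-variable fundamental theorem. At the boundary point [u] is not known to be
    differentiable, and the gradient of u^- is controlled only as a limit. The contradiction is
    therefore read off from finite increments of [u] along an axis-parallel path inside the disc,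
    where partial derivatives exist. The barrier is a polynomial in the squared distance, so every
    inequality is polynomial arithmetic. Which side of the curve is negative is settled by a single
    negative point near [x], whose sign is propagated along segments that avoid the boundary. *)

Section PartialDerivatives.
Context {R : realType}.
Implicit Types (f g : pl R -> R) (p : pl R).

(** A derivative in direction [e1] only sees the horizontal slice, so the mean value theorem, the
    fundamental theorem and the maximum tests of one variable apply to partial derivatives. *)
Lemma is_derive_e1P f p l :
  is_derive p (e1 R) f l <-> is_derive p.1 1 (fun t => f (t, p.2)) l.
Proof.
have E : (fun h => h^-1 *: ((f \o shift p) (h *: e1 R) - f p)) =
    (fun h : R => h^-1 *: (((fun t => f (t, p.2)) \o shift p.1) (h *: (1:R))
       - f (p.1, p.2))).
  apply/funext => h /=; rewrite -surjective_pairing; congr (_ *: (f _ - _)).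
  by case: p => a b; congr pair => /=; rewrite /GRing.scale /= ?mulr1 ?mulr0 ?add0r.
by split=> -[]; rewrite /derivable /derive => c v; split; rewrite /derivable /derive;
  move: c v; rewrite -?E.
Qed.

Lemma is_derive_e2P f p l :
  is_derive p (e2 R) f l <-> is_derive p.2 1 (fun t => f (p.1, t)) l.
Proof.
have E : (fun h => h^-1 *: ((f \o shift p) (h *: e2 R) - f p)) =
    (fun h : R => h^-1 *: (((fun t => f (p.1, t)) \o shift p.2) (h *: (1:R))
       - f (p.1, p.2))).
  apply/funext => h /=; rewrite -surjective_pairing; congr (_ *: (f _ - _)).
  by case: p => a b; congr pair => /=; rewrite /GRing.scale /= ?mulr1 ?mulr0 ?add0r.
by split=> -[]; rewrite /derivable /derive => c v; split; rewrite /derivable /derive;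
  move: c v; rewrite -?E.
Qed.

Lemma d1E f p l : is_derive p (e1 R) f l -> d1 f p = l.
Proof. by case. Qed.

Lemma d2E f p l : is_derive p (e2 R) f l -> d2 f p = l.
Proof. by case. Qed.

Lemma derivable_is_d1 f p : derivable f p (e1 R) -> is_derive p (e1 R) f (d1 f p).
Proof. by move=> /derivableP. Qed.

Lemma derivable_is_d2 f p : derivable f p (e2 R) -> is_derive p (e2 R) f (d2 f p).
Proof. by move=> /derivableP. Qed.

Lemma is_derive_mul f g p v df dg : is_derive p v f df -> is_derive p v g dg ->
  is_derive p v (fun y => f y * g y) (df * g p + f p * dg).
Proof.
move=> hf hg; apply: is_derive_eq.
by rewrite addrC; congr (_ + _); rewrite /GRing.scale /= // mulrC.
Qed.

Lemma continuous_slice1 (g : pl R -> R) (x y : R) : {for (x, y), continuous g} ->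
  {for x, continuous (fun t => g (t, y))}.
Proof.
move=> cg P /cg[[A B] [/= Ax By] sub]; apply: filterS Ax => t At.
by apply: (sub (t, y)); split => //=; exact: nbhs_singleton.
Qed.

Lemma continuous_slice2 (g : pl R -> R) (x y : R) : {for (x, y), continuous g} ->
  {for y, continuous (fun t => g (x, t))}.
Proof.
move=> cg P /cg[[A B] [/= Ax By] sub]; apply: filterS By => t Bt.
by apply: (sub (x, t)); split => //=; exact: nbhs_singleton.
Qed.

Lemma eq_continuous_open (V : set (pl R)) f g p : open V -> V p ->
  (forall q, V q -> f q = g q) -> {for p, continuous f} -> {for p, continuous g}.
Proof.
move=> oV Vp fg; rewrite /prop_for /continuous_at -(fg p Vp) => cf.
apply: cvg_trans cf; apply: near_eq_cvg.
by have : nbhs p V by [exact: open_nbhs_nbhs]; apply: filterS => q /fg.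
Qed.

End PartialDerivatives.

(** * Bumps in one variable *)

Section Bump.
Context {R : realType}.
Implicit Types (a b t : R) (n : nat).

Lemma is_derive_sqr_pos t : is_derive t 1 (fun s => Num.max s 0 ^+ 2) (2 * Num.max t 0).
Proof.
(* The remainder is at most [h ^+ 2] on both sides of the kink, so one estimate covers all signs of
   [t]; squaring is what makes the positive part C^1. *)
have key h : `|Num.max (h + t) 0 ^+ 2 - Num.max t 0 ^+ 2 - 2 * Num.max t 0 * h| <= h ^+ 2.
  by rewrite ler_norml /Num.max; case: ifPn => h1; case: ifPn => h2;
    rewrite -?leNgt in h1 h2; apply/andP; split; nra.
have C : h^-1 *: (((fun s => Num.max s 0 ^+ 2) \o shift t) (h *: (1:R)) - Num.max t 0 ^+ 2)
    @[h --> (0:R)^'] --> 2 * Num.max t 0.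
  apply/cvgrPdist_le => e e0; near=> h.
  have h0 : h != 0 by near: h; exact: nbhs_dnbhs_neq.
  rewrite /= /GRing.scale /= mulr1.
  rewrite (_ : _ - _ = - (h^-1 * (Num.max (h + t) 0 ^+ 2 - Num.max t 0 ^+ 2
     - 2 * Num.max t 0 * h))); last by field.
  rewrite normrN normrM normfV ler_pdivrMl ?normr_gt0//.
  apply: (le_trans (key h)).
  rewrite -real_normK ?num_real// expr2 ler_wpM2l//.
  near: h; exact: (dnbhs0_le e0).
by split; [apply/cvg_ex; eexists; exact: C|exact: cvg_lim C].
Unshelve. all: by end_near. Qed.

(** Equal to [1 - (1 + n z^2)^-1]: a C^1 function with values in [0, 1[ that tends to 1 as n grows
    wherever z > 0. C^1 is all that [C1c] asks, and a rational expression has an explicit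
    derivative. *)
Definition bump n a b t : R :=
  let z := Num.max ((t - a) * (b - t)) 0 in n%:R * z ^+ 2 / (1 + n%:R * z ^+ 2).

Definition dbump n a b t : R :=
  let z := Num.max ((t - a) * (b - t)) 0 in
  n%:R * (2 * z * (a + b - 2 * t)) / (1 + n%:R * z ^+ 2) ^+ 2.

Lemma bump_den_gt0 n (z : R) : 0 < 1 + n%:R * z ^+ 2.
Proof. by rewrite ltr_pwDl// mulr_ge0// sqr_ge0. Qed.

Lemma is_derive_bump n a b t : is_derive t 1 (bump n a b) (dbump n a b t).
Proof.
have hz : is_derive t 1 (fun t => (t - a) * (b - t)) (a + b - 2 * t).
  by apply: is_derive_eq; rewrite /GRing.scale /=; ring.
have hP : is_derive t 1 (fun t => Num.max ((t - a) * (b - t)) 0 ^+ 2)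
    (2 * Num.max ((t - a) * (b - t)) 0 * (a + b - 2 * t)).
  have := @is_derive1_comp _ (fun s => Num.max s 0 ^+ 2) (fun t => (t - a) * (b - t))
     t _ _ (is_derive_sqr_pos _) hz.
  by rewrite mulrC.
have hn : is_derive t 1 (fun t => 1 + n%:R * Num.max ((t - a) * (b - t)) 0 ^+ 2)
    (n%:R * (2 * Num.max ((t - a) * (b - t)) 0 * (a + b - 2 * t))).
  by apply: is_derive_eq; rewrite /GRing.scale /=; ring.
have hv := @is_deriveV _ (fun t => 1 + n%:R * Num.max ((t - a) * (b - t)) 0 ^+ 2) t _ 1
  (lt0r_neq0 (bump_den_gt0 n _)) hn.
have -> : bump n a b = (fun t => 1 - (1 + n%:R * Num.max ((t - a) * (b - t)) 0 ^+ 2)^-1).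
  apply/funext => s; rewrite /bump.
  have := lt0r_neq0 (bump_den_gt0 n (Num.max ((s - a) * (b - s)) 0)).
  by move=> ?; field.
apply: is_derive_eq; rewrite /dbump /GRing.scale /=.
have := lt0r_neq0 (bump_den_gt0 n (Num.max ((t - a) * (b - t)) 0)).
by move=> ?; field.
Qed.

Lemma continuous_bump n a b : continuous (bump n a b).
Proof.
move=> t; apply: differentiable_continuous; apply/derivable1_diffP.
by case: (is_derive_bump n a b t).
Qed.

Lemma continuous_dbump n a b : continuous (dbump n a b).
Proof.
have cz : continuous (fun t => (t - a) * (b - t)).
  by move=> t; apply: cvgM; apply: cvgB => //; exact: cvg_cst.
have cm : continuous (fun t => Num.max ((t - a) * (b - t)) 0).
  have E t : Num.max ((t - a) * (b - t)) 0 =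
      2^-1 * ((t - a) * (b - t) + `|(t - a) * (b - t)|).
    by rewrite /Num.max; case: ltP => h; [rewrite ltr0_norm//|rewrite ger0_norm//]; lra.
  rewrite (_ : (fun t => _) = (fun t => 2^-1 * ((t - a) * (b - t) + `|(t - a) * (b - t)|)));
    last exact/funext.
  move=> t.
  apply: cvgM; first exact: cvg_cst.
  by apply: cvgD; [exact: cz|apply: cvg_norm; exact: cz].
move=> t; rewrite /dbump.
apply: cvgM; last first.
  apply: cvgV; first by rewrite lt0r_neq0// exprn_gt0// bump_den_gt0.
  rewrite -[X in _ --> X]mulr1; under eq_fun do rewrite expr2.
  rewrite mulr1 expr2; apply: cvgM; apply: cvgD; try exact: cvg_cst;
  apply: cvgM; try exact: cvg_cst; under eq_fun do rewrite expr2;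
  rewrite expr2; apply: cvgM; exact: cm.
apply: cvgM; first exact: cvg_cst.
apply: cvgM; first by apply: cvgM; [exact: cvg_cst|exact: cm].
by apply: cvgB; [exact: cvg_cst|apply: cvgM; [exact: cvg_cst|exact: cvg_id]].
Qed.

(** The order [a <= b] matters: for [b < a] the product [(t - a) * (b - t)] would be positive
    between [b] and [a]. *)
Lemma bump_out n a b t : a <= b -> ~~ (a < t < b) -> bump n a b t = 0.
Proof.
move=> ab abt; rewrite /bump max_r ?expr0n ?mulr0 ?mul0r//.
by move: abt; rewrite negb_and -!leNgt => /orP[] ?; nra.
Qed.

Lemma dbump_out n a b t : a <= b -> ~~ (a < t < b) -> dbump n a b t = 0.
Proof.
move=> ab abt; rewrite /dbump max_r ?(mulr0, mul0r)//.
by move: abt; rewrite negb_and -!leNgt => /orP[] ?; nra.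
Qed.

Lemma bump_ge0 n a b t : 0 <= bump n a b t.
Proof. by rewrite /bump divr_ge0 ?(ltW (bump_den_gt0 n _))// mulr_ge0 ?sqr_ge0. Qed.

Lemma bump_le1 n a b t : bump n a b t <= 1.
Proof. by rewrite /bump ler_pdivrMr ?bump_den_gt0// mul1r lerDr. Qed.

Lemma cvg_bump a b t : a < t < b -> bump n a b t @[n --> \oo] --> (1 : R).
Proof.
move=> /andP[at_ tb].
have z0 : 0 < (t - a) * (b - t) by rewrite mulr_gt0 ?subr_gt0.
pose w := ((t - a) * (b - t)) ^+ 2.
have w0 : 0 < w by rewrite exprn_gt0.
have E n : bump n a b t = 1 - (1 + n%:R * w)^-1.
  rewrite /bump (max_l (ltW z0)) -/w.
  have : 1 + n%:R * w != 0 by rewrite lt0r_neq0// ltr_pwDl// mulr_ge0// ltW.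
  by move=> ?; field.
rewrite (_ : (fun n => _) = (fun n => 1 - (1 + n%:R * w)^-1)); last exact/funext.
rewrite -[X in _ --> X]subr0; apply: cvgB; first exact: cvg_cst.
apply/cvgrPdist_lt => e e0; near=> n.
have nw : 0 <= n%:R * w by rewrite mulr_ge0// ltW.
rewrite sub0r normrN ger0_norm ?invr_ge0 ?addr_ge0//.
rewrite invf_plt ?posrE ?ltr_pwDl//.
rewrite -ler_pdivrMr//.
near: n; exact: nbhs_infty_ger.
Unshelve. all: by end_near. Qed.

End Bump.

(** * Boxes and product bumps in the plane *)

Section Bump2.
Context {R : realType}.
Implicit Types (a b c d t : R) (n : nat) (p : pl R).

Definition cbox a b c d : set (pl R) := `[a, b]%classic `*` `[c, d]%classic.
Definition obox a b c d : set (pl R) := `]a, b[%classic `*` `]c, d[%classic.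

Definition bump2 n a b c d p : R := bump n a b p.1 * bump n c d p.2.

Lemma obox_sub_cbox a b c d : obox a b c d `<=` cbox a b c d.
Proof. by move=> p [p1 p2]; split; apply: subset_itv_oo_cc. Qed.

Lemma compact_cbox a b c d : compact (cbox a b c d).
Proof. by apply: compact_setX; exact: segment_compact. Qed.

Lemma closed_cbox a b c d : closed (cbox a b c d).
Proof. by apply: compact_closed; [exact: norm_hausdorff|exact: compact_cbox]. Qed.

Lemma open_obox a b c d : open (obox a b c d).
Proof.
rewrite openE => p [p1 p2]; exists (`]a, b[%classic, `]c, d[%classic) => //.
by split; apply: open_nbhs_nbhs; split => //; exact: interval_open.
Qed.

Lemma obox_nbhs p (A : set (pl R)) : nbhs p A ->
  exists2 e : R, 0 < e & cbox (p.1 - e) (p.1 + e) (p.2 - e) (p.2 + e) `<=` A.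
Proof.
(* Half the radius, since the box is closed while the ball is open. *)
move=> /nbhs_ballP[e /= e0 eA]; exists (e / 2); first by rewrite divr_gt0.
move=> q [q1 q2]; apply: eA; move: q1 q2; rewrite /= !in_itv /= => /andP[? ?] /andP[? ?].
by split; rewrite /ball /= ltr_norml; apply/andP; split; lra.
Qed.

Lemma is_derive_bump2_e1 n a b c d p :
  is_derive p (e1 R) (bump2 n a b c d) (dbump n a b p.1 * bump n c d p.2).
Proof.
apply/is_derive_e1P; rewrite /bump2 /=.
have h := is_derive_bump n a b p.1.
by apply: is_derive_eq; rewrite /GRing.scale /=; ring.
Qed.

Lemma is_derive_bump2_e2 n a b c d p :
  is_derive p (e2 R) (bump2 n a b c d) (bump n a b p.1 * dbump n c d p.2).
Proof.
apply/is_derive_e2P; rewrite /bump2 /=.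
have h := is_derive_bump n c d p.2.
by apply: is_derive_eq; rewrite /GRing.scale /=; ring.
Qed.

Lemma d1_bump2 n a b c d p : d1 (bump2 n a b c d) p = dbump n a b p.1 * bump n c d p.2.
Proof. exact/d1E/is_derive_bump2_e1. Qed.

Lemma d2_bump2 n a b c d p : d2 (bump2 n a b c d) p = bump n a b p.1 * dbump n c d p.2.
Proof. exact/d2E/is_derive_bump2_e2. Qed.

Lemma continuous_mul12 (f g : R -> R) : continuous f -> continuous g ->
  continuous (fun p : pl R => f p.1 * g p.2).
Proof.
move=> cf cg p; apply: cvgM.
  by apply: continuous_comp; [exact: cvg_fst|exact: cf].
by apply: continuous_comp; [exact: cvg_snd|exact: cg].
Qed.

Lemma continuous_bump2 n a b c d : continuous (bump2 n a b c d).
Proof. by apply: continuous_mul12; exact: continuous_bump. Qed.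

Lemma continuous_d1_bump2 n a b c d : continuous (d1 (bump2 n a b c d)).
Proof.
have -> : d1 (bump2 n a b c d) = (fun p => dbump n a b p.1 * bump n c d p.2).
  by apply/funext => p; rewrite d1_bump2.
by apply: continuous_mul12; [exact: continuous_dbump|exact: continuous_bump].
Qed.

Lemma continuous_d2_bump2 n a b c d : continuous (d2 (bump2 n a b c d)).
Proof.
have -> : d2 (bump2 n a b c d) = (fun p => bump n a b p.1 * dbump n c d p.2).
  by apply/funext => p; rewrite d2_bump2.
by apply: continuous_mul12; [exact: continuous_bump|exact: continuous_dbump].
Qed.

Lemma bump2_out n a b c d p : a <= b -> c <= d -> ~ obox a b c d p ->
  [/\ bump2 n a b c d p = 0, d1 (bump2 n a b c d) p = 0 & d2 (bump2 n a b c d) p = 0].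
Proof.
move=> ab cd np; rewrite d1_bump2 d2_bump2 /bump2.
have [p1|p1] := boolP (a < p.1 < b); last first.
  by rewrite (bump_out n ab p1) (dbump_out n ab p1) !mul0r.
have [p2|p2] := boolP (c < p.2 < d); last first.
  by rewrite (bump_out n cd p2) (dbump_out n cd p2) !mulr0.
by exfalso; apply: np; split; rewrite /= in_itv.
Qed.

Lemma bump2_C1c (U : set (pl R)) n a b c d : a <= b -> c <= d ->
  cbox a b c d `<=` U -> C1c U (bump2 n a b c d).
Proof.
move=> ab cd bU.
have sub : closure [set x | bump2 n a b c d x != 0] `<=` cbox a b c d.
  rewrite [X in _ `<=` X](closure_id _).1; last exact: closed_cbox.
  apply: closure_subset => p /= /eqP p0; apply: obox_sub_cbox.
  by apply: contrapT => np; apply: p0; case: (bump2_out n ab cd np).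
split; last split.
- split; first by move=> p; split; [case: (is_derive_bump2_e1 n a b c d p)|
    case: (is_derive_bump2_e2 n a b c d p)].
  by split; [exact: continuous_bump2|split; [exact: continuous_d1_bump2|
     exact: continuous_d2_bump2]].
- by apply: subclosed_compact sub; [exact: closed_closure|exact: compact_cbox].
- exact: subset_trans sub bU.
Qed.

End Bump2.

(** * Measurability, and integrals of derivatives over boxes *)

Section Measure.
Context {R : realType}.
Implicit Types (a b c d t : R) (n : nat) (p : pl R) (V : set (pl R)).
Local Notation mu2 := (@mu2 R).
Local Notation mT := (measurableTypeR R * measurableTypeR R)%type.

Lemma measurable_obox a b c d : measurable (obox a b c d : set mT).
Proof. by apply: measurableX; exact: measurable_itv. Qed.

Lemma measurable_cbox a b c d : measurable (cbox a b c d : set mT).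
Proof. by apply: measurableX; exact: measurable_itv. Qed.

(** The measurable sets are those of the product sigma-algebra, so an open set has to be a countable
    union of boxes. Their corners are rational and they are indexed by [nat] through [pickle]; an
    index that codes no box inside [V] contributes [set0]. *)
Lemma open_measurable_pl V : open V -> measurable (V : set mT).
Proof.
move=> oV.
pose F (q : (rat * rat) * (rat * rat)) : set (pl R) :=
  obox (ratr q.1.1) (ratr q.1.2) (ratr q.2.1) (ratr q.2.2).
pose G (k : nat) : set (pl R) := if unpickle k is Some q then
  (if pselect (F q `<=` V) then F q else set0) else set0.
have -> : V = \bigcup_k G k.
  apply/seteqP; split => [p Vp|p [k _]]; last first.
    by rewrite /G; case: unpickle => // q; case: pselect => // qV /qV.
  have [e e0 eV] : exists2 e : R, 0 < e &
      cbox (p.1 - e) (p.1 + e) (p.2 - e) (p.2 + e) `<=` V.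
    by apply: obox_nbhs; exact: open_nbhs_nbhs.
  have [q1] := @rat_in_itvoo R (p.1 - e) p.1 ltac:(lra).
  have [q2] := @rat_in_itvoo R p.1 (p.1 + e) ltac:(lra).
  have [q3] := @rat_in_itvoo R (p.2 - e) p.2 ltac:(lra).
  have [q4] := @rat_in_itvoo R p.2 (p.2 + e) ltac:(lra).
  rewrite !in_itv /= => /andP[h1 h2] /andP[h3 h4] /andP[h5 h6] /andP[h7 h8].
  exists (pickle ((q1, q2), (q3, q4))); [exact: I|rewrite /G pickleK].
  case: pselect => [?|nF] /=; first by split; rewrite /= in_itv /=; apply/andP.
  exfalso; apply: nF.
  move=> y [/=]; rewrite !in_itv /= => /andP[? ?] /andP[? ?]; apply: eV.
  by split; rewrite /= in_itv /=; apply/andP; split; lra.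
apply: bigcupT_measurable => k; rewrite /G; case: unpickle => // q.
by case: pselect => [?|?] //=; exact: measurable_obox.
Qed.

Lemma continuous_measurable_pl V (g : pl R -> R) : open V ->
  (forall p, V p -> {for p, continuous g}) -> measurable_fun (V : set mT) (g : mT -> R).
Proof.
move=> oV cg mV; apply: (measurability _ (RGenOpens.measurableE R)) => //.
move=> _ [_ [a [b ->] <-]]; apply: open_measurable_pl.
rewrite openE => p [Vp gp]; apply: filterI; first exact: open_nbhs_nbhs.
apply: (cg p Vp); apply: open_nbhs_nbhs; split => //; exact: interval_open.
Qed.

Lemma mu2_cbox_fin a b c d : (mu2 (cbox a b c d) < +oo)%E.
Proof.
rewrite /Defs.mu2 /cbox product_measure1E; try exact: measurable_itv.
rewrite [X in (X * _)%E](lebesgue_measure_itv `[a, b]).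
rewrite [X in (_ * X)%E](lebesgue_measure_itv `[c, d]) /=; do 2 case: ifP => _; rewrite ?mul0e ?mule0 ?ltry//.
Qed.

Lemma mu2_obox_gt0 a b c d : a < b -> c < d -> (0 < mu2 (obox a b c d))%E.
Proof.
move=> ab cd; rewrite /Defs.mu2 /obox product_measure1E; try exact: measurable_itv.
rewrite [X in (X * _)%E](lebesgue_measure_itv `]a, b[).
rewrite [X in (_ * X)%E](lebesgue_measure_itv `]c, d[) /=.
by rewrite !lte_fin ab cd -!EFinB -EFinM lte_fin mulr_gt0 ?subr_gt0.
Qed.

Lemma continuous_integrable_cbox V (g : pl R -> R) a b c d : open V ->
  (forall p, V p -> {for p, continuous g}) -> cbox a b c d `<=` V ->
  mu2.-integrable (cbox a b c d) (EFin \o g).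
Proof.
move=> oV cg KV; apply: measurable_bounded_integrable.
- exact: measurable_cbox.
- exact: mu2_cbox_fin.
- apply: measurable_funS KV _; first exact: open_measurable_pl.
  exact: continuous_measurable_pl.
- have : compact (g @` cbox a b c d).
    apply: continuous_compact; last exact: compact_cbox.
    by apply: continuous_in_subspaceT => p /set_mem /KV; exact: cg.
  move=> /compact_bounded; rewrite /bounded_set /bounded_near.
  by apply: filterS => M h p Kp; apply: h; exists p.
Qed.

(** By Fubini and the fundamental theorem on each horizontal slice, only the differences
    [F (b, y) - F (a, y)] remain; hence a condition on the vertical sides. *)
Lemma integral_d1_eq0 V (F : pl R -> R) a b c d : a < b -> open V ->
  cbox a b c d `<=` V ->
  (forall p, V p -> derivable F p (e1 R) /\ {for p, continuous (d1 F)}) ->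
  (forall y, F (a, y) = 0 /\ F (b, y) = 0) ->
  (\int[mu2]_(p in cbox a b c d) (d1 F p)%:E = 0)%E.
Proof.
move=> ab oV KV hF F0.
have iF : mu2.-integrable (cbox a b c d) (EFin \o d1 F).
  by apply: continuous_integrable_cbox KV => // p /hF[].
have iF' : mu2.-integrable setT ((EFin \o d1 F) \_ (cbox a b c d)).
  exact: ((integrable_mkcond (EFin \o d1 F : mT -> \bar R) (measurable_cbox a b c d)).1 iF).
(* Fubini is applied on the whole plane, hence the extension by zero; the order makes the inner
   integral run in the direction of the derivative. *)
rewrite integral_mkcond -[LHS](integral21_prod_meas1 iF').
apply: integral0_eq => y _; rewrite /fubini_G.
have [cdy|ncdy] := boolP (c <= y <= d); last first.
  apply: integral0_eq => x _; rewrite patchE memNset// => -[_].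
  by rewrite /= in_itv /=; exact/negP.
transitivity (\int[lebesgue_measure]_(x in `[a, b]) (d1 F (x, y))%:E)%E.
  rewrite [RHS]integral_mkcond; apply: eq_integral => x _; rewrite !patchE.
  have [xab|xab] := boolP (x \in `[a, b]%classic).
    by rewrite mem_set//; split; [exact: (set_mem xab)|rewrite /= in_itv].
  by rewrite memNset// => -[/= h _]; move/negP: xab; apply; rewrite inE.
have dF x : a <= x <= b -> is_derive x 1 (fun x => F (x, y)) (d1 F (x, y)).
  move=> abx; apply/(is_derive_e1P F (x, y)).
  by apply/derivable_is_d1/(hF _ _).1/KV; split; rewrite /= in_itv.
have cF x : a <= x <= b -> {for x, continuous (fun x => F (x, y))}.
  by move=> /dF[h _]; apply: differentiable_continuous; exact/derivable1_diffP.
rewrite (@continuous_FTC2 _ _ (fun x => F (x, y))) //.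
- by have [-> ->] := F0 y; rewrite subee.
- apply: continuous_in_subspaceT => x /set_mem; rewrite /= in_itv /= => abx.
  apply: continuous_slice1.
  by apply: (hF _ _).2; apply: KV; split; rewrite /= in_itv.
- split.
  + by move=> x; rewrite in_itv /= => /andP[ax xb]; case: (dF x); rewrite ?ltW.
  + by apply: cvg_at_right_filter; apply: cF; rewrite lexx ltW.
  + by apply: cvg_at_left_filter; apply: cF; rewrite lexx ltW.
- move=> x; rewrite in_itv /= => /andP[ax xb]; rewrite derive1E.
  by case: (dF x); rewrite ?ltW.
Qed.

Lemma integral_d2_eq0 V (F : pl R -> R) a b c d : c < d -> open V ->
  cbox a b c d `<=` V ->
  (forall p, V p -> derivable F p (e2 R) /\ {for p, continuous (d2 F)}) ->
  (forall x, F (x, c) = 0 /\ F (x, d) = 0) ->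
  (\int[mu2]_(p in cbox a b c d) (d2 F p)%:E = 0)%E.
Proof.
move=> cd oV KV hF F0.
have iF : mu2.-integrable (cbox a b c d) (EFin \o d2 F).
  by apply: continuous_integrable_cbox KV => // p /hF[].
have iF' : mu2.-integrable setT ((EFin \o d2 F) \_ (cbox a b c d)).
  exact: ((integrable_mkcond (EFin \o d2 F : mT -> \bar R) (measurable_cbox a b c d)).1 iF).
rewrite integral_mkcond -[LHS](integral12_prod_meas1 iF').
apply: integral0_eq => x _; rewrite /fubini_F.
have [abx|nabx] := boolP (a <= x <= b); last first.
  apply: integral0_eq => y _; rewrite patchE memNset// => -[+ _].
  by rewrite /= in_itv /=; exact/negP.
transitivity (\int[lebesgue_measure]_(y in `[c, d]) (d2 F (x, y))%:E)%E.
  rewrite [RHS]integral_mkcond; apply: eq_integral => y _; rewrite !patchE.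
  have [ycd|ycd] := boolP (y \in `[c, d]%classic).
    by rewrite mem_set//; split; [rewrite /= in_itv|exact: (set_mem ycd)].
  by rewrite memNset// => -[/= _ h]; move/negP: ycd; apply; rewrite inE.
have dF y : c <= y <= d -> is_derive y 1 (fun y => F (x, y)) (d2 F (x, y)).
  move=> cdy; apply/(is_derive_e2P F (x, y)).
  by apply/derivable_is_d2/(hF _ _).1/KV; split; rewrite /= in_itv.
have cF y : c <= y <= d -> {for y, continuous (fun y => F (x, y))}.
  by move=> /dF[h _]; apply: differentiable_continuous; exact/derivable1_diffP.
rewrite (@continuous_FTC2 _ _ (fun y => F (x, y))) //.
- by have [-> ->] := F0 x; rewrite subee.
- apply: continuous_in_subspaceT => y /set_mem; rewrite /= in_itv /= => cdy.
  apply: continuous_slice2.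
  by apply: (hF _ _).2; apply: KV; split; rewrite /= in_itv.
- split.
  + by move=> y; rewrite in_itv /= => /andP[ay yb]; case: (dF y); rewrite ?ltW.
  + by apply: cvg_at_right_filter; apply: cF; rewrite lexx ltW.
  + by apply: cvg_at_left_filter; apply: cF; rewrite lexx ltW.
- move=> y; rewrite in_itv /= => /andP[ay yb]; rewrite derive1E.
  by case: (dF y); rewrite ?ltW.
Qed.

End Measure.

(** * The fundamental lemma of the calculus of variations on a box *)

Section FundamentalLemma.

(** Dynkin's argument: for integrable [h], the sets [A] with vanishing integral form a
    lambda-system, so a generating pi-system decides. The map [X] is left free to serve for both
    projections and for the identity. *)
Lemma integral_preimage_eq0 (d d' : measure_display) (T : measurableType d)
    (T' : measurableType d') (R : realType) (mu : {measure set T -> \bar R})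
    (D : set T) (h : T -> \bar R) (X : T -> T') (G : set (set T')) :
  measurable D -> mu.-integrable D h -> measurable_fun setT X ->
  @measurable _ T' = <<s G >> -> setI_closed G ->
  (\int[mu]_(x in D) h x = 0)%E ->
  (forall A, G A -> \int[mu]_(x in D `&` X @^-1` A) h x = 0)%E ->
  forall A, measurable A -> (\int[mu]_(x in D `&` X @^-1` A) h x = 0)%E.
Proof.
move=> mD ih mX GE GI D0 G0 A; rewrite GE.
have mXD S : measurable S -> measurable (D `&` X @^-1` S).
  by move=> mS; apply: measurableI => //; rewrite -[X @^-1` S]setTI; exact: mX.
pose P := [set A : set T' | (\int[mu]_(x in D `&` X @^-1` A) h x = 0)%E].
move: A; apply: (@dynkin_induction _ _ G P) => //.
- by rewrite /P /= preimage_setT setIT.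
- move=> S mS PS; rewrite /P /=.
  have DE : D = (D `&` X @^-1` S) `|` (D `&` X @^-1` (~` S)).
    by rewrite -setIUr preimage_setC setUv setIT.
  have := D0; rewrite {1}DE integral_setU //.
  + by rewrite [X in (X + _)%E]PS add0e.
  + exact: mXD.
  + by apply: mXD; exact: measurableC.
  + by rewrite -DE; case/integrableP: ih.
  + by apply/disj_setPS => x [[_ ?] [_ ?]].
- move=> F mF tF PF; rewrite /P /= preimage_bigcup setI_bigcupr integral_bigcup.
  + by rewrite eseries0// => i _ _; exact: PF.
  + apply/trivIsetP => i j _ _ ij; move/trivIsetP: tF => /(_ i j I I ij) FF.
    rewrite -subset0 => x [[_ Fi] [_ Fj]].
    by have : (F i `&` F j) (X x) by []; rewrite FF.
  + by move=> k; exact: mXD.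
  + rewrite -setI_bigcupr -preimage_bigcup; apply: integrableS ih => //.
    by apply: mXD; exact: bigcupT_measurable.
Qed.

Context {R : realType}.
Implicit Types (a b c d s t : R).
Local Notation mu2 := (@mu2 R).
Local Notation mT := (measurableTypeR R * measurableTypeR R)%type.

Lemma setI_itvoo (s t s' t' : R) : `]s, t[%classic `&` `]s', t'[%classic =
  `](Num.max s s'), (Num.min t t')[%classic.
Proof.
apply/seteqP; split => x; rewrite /= !in_itv /= gt_max lt_min.
  by move=> [/andP[-> ->] /andP[-> ->]].
by move=> /andP[/andP[-> ->] /andP[-> ->]].
Qed.

Lemma RGenOpens_setI_closed : setI_closed (@RGenOpens.G R).
Proof.
by move=> _ _ [s [t ->]] [s' [t' ->]]; rewrite setI_itvoo; eexists; eexists.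
Qed.

(** Boxes are upgraded one coordinate at a time: intervals become measurable sets along [fst], then
    along [snd]; finally rectangles become arbitrary measurable sets with the identity map. *)
Lemma ae_eq0_boxes (K : set (pl R)) (h : pl R -> R) a b c d :
  measurable (K : set mT) -> K `<=` cbox a b c d -> mu2.-integrable K (EFin \o h) ->
  (forall s t s' t', (\int[mu2]_(p in K `&` obox s t s' t') (h p)%:E = 0)%E) ->
  ae_eq mu2 K (EFin \o h) (cst 0%E).
Proof.
move=> mK KC ih h0.
(* The whole line is not among the generating intervals, but one exceeding the shadow of [K] by 1
   cuts nothing off [K]; it supplies the total integral from which the Dynkin argument starts. *)
have KW1 : K `<=` `]a - 1, b + 1[%classic `*` setT.
  by move=> p /KC[/= + _]; rewrite !in_itv /= => /andP[? ?]; split; last exact: I;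
    rewrite /= ?in_itv /=; apply/andP; split; lra.
have KW2 : K `<=` setT `*` `]c - 1, d + 1[%classic.
  by move=> p /KC[/= _ +]; rewrite !in_itv /= => /andP[? ?]; split; first exact: I;
    rewrite /= ?in_itv /=; apply/andP; split; lra.
have mX (A B : set (measurableTypeR R)) : measurable A -> measurable B ->
    measurable (K `&` (A `*` B) : set mT).
  by move=> mA mB; apply: measurableI => //; exact: measurableX.
have iX (A B : set (measurableTypeR R)) : measurable A -> measurable B ->
    mu2.-integrable (K `&` (A `*` B)) (EFin \o h).
  by move=> mA mB; apply: integrableS ih => //; exact: mX.
have step1 (A : set (measurableTypeR R)) s t : measurable A ->
    (\int[mu2]_(p in K `&` (A `*` `]s, t[%classic)) (h p)%:E = 0)%E.
  move=> mA.
  have := @integral_preimage_eq0 _ _ _ _ R mu2 (K `&` (setT `*` `]s, t[%classic))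
     (EFin \o h) fst (@RGenOpens.G R).
  rewrite (_ : K `&` (A `*` `]s, t[%classic) =
    K `&` (setT `*` `]s, t[%classic) `&` fst @^-1` A); last first.
    by apply/seteqP; split => p [] => [Kp [Ap sp]|[Kp [_ sp]] Ap].
  apply => //.
  - by apply: mX => //; exact: measurable_itv.
  - by apply: iX => //; exact: measurable_itv.
  - exact: RGenOpens.measurableE.
  - exact: RGenOpens_setI_closed.
  - rewrite -[RHS](h0 (a - 1) (b + 1) s t); congr (integral _ _ _).
    by apply/seteqP; split => p [Kp [p1 p2]]; split => //; split => //; case: (KW1 _ Kp).
  - move=> _ [s' [t' ->]]; rewrite -[RHS](h0 s' t' s t); congr (integral _ _ _).
    by apply/seteqP; split => p [] => [[Kp [_ p2] p1]|Kp [p1 p2]].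
have step2 (A B : set (measurableTypeR R)) : measurable A -> measurable B ->
    (\int[mu2]_(p in K `&` (A `*` B)) (h p)%:E = 0)%E.
  move=> mA mB.
  have := @integral_preimage_eq0 _ _ _ _ R mu2 (K `&` (A `*` setT))
     (EFin \o h) snd (@RGenOpens.G R).
  rewrite (_ : K `&` (A `*` B) = K `&` (A `*` setT) `&` snd @^-1` B); last first.
    by apply/seteqP; split => p [] => [Kp [Ap Bp]|[Kp [Ap _]] Bp].
  apply => //.
  - exact: mX.
  - exact: iX.
  - exact: RGenOpens.measurableE.
  - exact: RGenOpens_setI_closed.
  - rewrite -[RHS](step1 A (c - 1) (d + 1) mA); congr (integral _ _ _).
    by apply/seteqP; split => p [Kp [p1 p2]]; split => //; split => //; case: (KW2 _ Kp).
  - move=> _ [s' [t' ->]]; rewrite -[RHS](step1 A s' t' mA); congr (integral _ _ _).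
    by apply/seteqP; split => p [] => [[Kp [p1 _] p2]|Kp [p1 p2]].
(* It is enough that the integral vanishes over every measurable part [E] of [K]. *)
apply: integral_ae_eq => // E EK mE; rewrite integral0.
rewrite -(setIidr EK).
apply: (@integral_preimage_eq0 _ _ _ _ R mu2 K (EFin \o h) id
   [set A `*` B | A in measurable & B in measurable]) => //.
- exact: measurable_prod_measurableType.
- move=> _ _ [A mA [B mB <-]] [A' mA' [B' mB' <-]]; exists (A `&` A'); first exact: measurableI.
  exists (B `&` B'); first exact: measurableI.
  by rewrite setXI.
- rewrite -[RHS](step2 setT setT)//; congr (integral _ _ _).
  by apply/seteqP; split => p // [].
- by move=> _ [A mA [B mB <-]]; exact: step2.
Qed.

(* The bumps [bump2 n] increase to the indicator of the open box, so that
   dominated convergence turns vanishing against bumps into vanishing on boxes. *)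
Lemma fundamental_lemma (h : pl R -> R) a b c d :
  mu2.-integrable (obox a b c d) (EFin \o h) ->
  (forall n s t s' t', a <= s -> s < t -> t <= b -> c <= s' -> s' < t' -> t' <= d ->
    (\int[mu2]_(p in obox a b c d) (h p * bump2 n s t s' t' p)%:E = 0)%E) ->
  ae_eq mu2 (obox a b c d) (EFin \o h) (cst 0%E).
Proof.
move=> ih h0; pose K := obox a b c d.
have mK : measurable (K : set mT) by exact: measurable_obox.
apply: (@ae_eq0_boxes _ _ a b c d) => //; first exact: obox_sub_cbox.
have mh : measurable_fun (K : set mT) (h : mT -> R) by move/integrableP: ih => [/measurable_EFinP].
have sub0 s t s' t' : a <= s -> s < t -> t <= b -> c <= s' -> s' < t' -> t' <= d ->
    (\int[mu2]_(p in obox s t s' t') (h p)%:E = 0)%E.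
  move=> as_ st tb cs st' td.
  have sK : obox s t s' t' `<=` K.
    by move=> p [/=]; rewrite !in_itv /= => /andP[? ?] /andP[? ?]; split;
      rewrite /= in_itv /=; apply/andP; split; lra.
  pose g := (fun p => (h p)%:E) \_ (obox s t s' t').
  have mg : measurable_fun (K : set mT) g.
    apply: (measurable_restrict _ (measurable_obox s t s' t') mK).1.
    rewrite setIidr//; apply: measurable_funS sK _ => //; exact/measurable_EFinP.
  have mb n : measurable_fun (K : set mT) (bump2 n s t s' t' : mT -> R).
    apply: (@measurable_funS _ _ _ _ setT) => //.
    by apply: continuous_measurable_pl; [exact: openT|move=> p _; exact: continuous_bump2].
  have [] := @dominated_convergence _ _ R mu2 K mK
    (fun n p => (h p * bump2 n s t s' t' p)%:E) g (fun p => `|h p|%:E).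
  - by move=> n; apply/measurable_EFinP; apply: measurable_funM.
  - exact: mg.
  - apply: aeW => p Kp; rewrite /g patchE; case: ifPn => [/set_mem|/negP] sp.
      apply: cvg_EFin; first exact: nearW.
      rewrite -[X in _ --> X]mulr1 -[X in _ --> X](mulr1 (h p * 1)) -mulrA.
      apply: cvgM; first exact: cvg_cst.
      by case: sp; rewrite /= !in_itv /= => p1 p2; apply: cvgM; exact: cvg_bump.
    have -> : (fun n => (h p * bump2 n s t s' t' p)%:E) = cst 0%E.
      apply/funext => n; rewrite (_ : bump2 n s t s' t' p = 0) ?mulr0//.
      by have [] := bump2_out n (ltW st) (ltW st') (fun h => sp (mem_set h)).
    exact: cvg_cst.
  - by have := integrable_norm ih.
  - apply: aeW => p n _; rewrite /= lee_fin normrM ler_piMr// ger0_norm.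
      by rewrite mulr_ile1 ?bump_ge0 ?bump_le1.
    by rewrite mulr_ge0 ?bump_ge0.
  - move=> _ _; rewrite (_ : (fun n => _) = cst 0%E); last first.
      by apply/funext => n; exact: h0.
    move=> /(cvg_unique _ (cvg_cst _)) => /(_ (@ereal_hausdorff R)).
    rewrite /g -integral_mkcondr setIidr// => <-//.
(* A box with arbitrary sides meets [K] in a box inside [K] or in the empty set. *)
move=> s t s' t'.
have -> : K `&` obox s t s' t' =
    obox (Num.max a s) (Num.min b t) (Num.max c s') (Num.min d t').
  by rewrite /K /obox -setXI !setI_itvoo.
have [h1|h1] := ltP (Num.max a s) (Num.min b t); last first.
  by rewrite /obox set_itv_ge ?set0X ?integral_set0//= bnd_simp -leNgt.
have [h2|h2] := ltP (Num.max c s') (Num.min d t'); last first.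
  by rewrite /obox [X in _ `*` X]set_itv_ge ?setX0 ?integral_set0//= bnd_simp -leNgt.
by apply: sub0 => //; rewrite ?le_max ?ge_min lexx.
Qed.

End FundamentalLemma.

(** * Symmetry of second derivatives *)

Section Schwarz.
Context {R : realType}.
Implicit Types (u : pl R -> R) (p : pl R) (V : set (pl R)).

Lemma MVT_cc (f df : R -> R) (a b : R) : a < b ->
  (forall x, a <= x <= b -> is_derive x 1 f (df x)) ->
  exists2 c, a < c < b & f b - f a = df c * (b - a).
Proof.
move=> ab hf.
have [||c] := @MVT R f df a b ab; last by rewrite in_itv /=; exists c.
  by move=> x; rewrite in_itv /= => /andP[ax xb]; apply: hf; rewrite !ltW.
apply: continuous_in_subspaceT => x /set_mem; rewrite /= in_itv /= => /hf[h _].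
by apply: differentiable_continuous; exact/derivable1_diffP.
Qed.

(** Two mean value steps on a square: a horizontal one for the difference of two slices, then a
    vertical one for [d1 u]. The twin lemma takes them in the other order and evaluates the same
    second difference. *)
Lemma second_difference_d2d1 u (x y h : R) : 0 < h ->
  (forall q, cbox x (x + h) y (y + h) q ->
     derivable u q (e1 R) /\ derivable (d1 u) q (e2 R)) ->
  exists2 q, cbox x (x + h) y (y + h) q &
    u (x + h, y + h) - u (x + h, y) - (u (x, y + h) - u (x, y)) =
    d2 (d1 u) q * h * h.
Proof.
move=> h0 hu.
have inb s t : x <= s <= x + h -> y <= t <= y + h -> cbox x (x + h) y (y + h) (s, t).
  by move=> ? ?; split; rewrite /= in_itv.
have x0 : x <= x <= x + h by apply/andP; split; lra.
have x1 : x <= x + h <= x + h by apply/andP; split; lra.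
have y0 : y <= y <= y + h by apply/andP; split; lra.
have y1 : y <= y + h <= y + h by apply/andP; split; lra.
have [|s|s /andP[s1 s2] Es] := @MVT_cc (fun s => u (s, y + h) - u (s, y))
  (fun s => d1 u (s, y + h) - d1 u (s, y)) x (x + h); first lra.
  move=> hs.
  have q1 : is_derive s 1 (fun s => u (s, y + h)) (d1 u (s, y + h)).
    apply/(is_derive_e1P u (s, y + h)); apply: derivable_is_d1.
    exact: (hu _ (inb _ _ hs y1)).1.
  have q2 : is_derive s 1 (fun s => u (s, y)) (d1 u (s, y)).
    apply/(is_derive_e1P u (s, y)); apply: derivable_is_d1.
    exact: (hu _ (inb _ _ hs y0)).1.
  exact: is_deriveB.
have hs : x <= s <= x + h by rewrite !ltW.
have [|t|t /andP[t1 t2] Et] := @MVT_cc (fun t => d1 u (s, t))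
  (fun t => d2 (d1 u) (s, t)) y (y + h); first lra.
  move=> ht; apply/(is_derive_e2P (d1 u) (s, t)).
  exact: derivable_is_d2 (hu (s, t) (inb _ _ hs ht)).2.
exists (s, t); first by apply: inb => //; rewrite !ltW.
have -> : d2 (d1 u) (s, t) * h * h = (d2 (d1 u) (s, t) * (y + h - y)) * h by ring.
by rewrite -Et; move: Es; rewrite (_ : x + h - x = h); [move=> <-|ring].
Qed.

Lemma second_difference_d1d2 u (x y h : R) : 0 < h ->
  (forall q, cbox x (x + h) y (y + h) q ->
     derivable u q (e2 R) /\ derivable (d2 u) q (e1 R)) ->
  exists2 q, cbox x (x + h) y (y + h) q &
    u (x + h, y + h) - u (x + h, y) - (u (x, y + h) - u (x, y)) =
    d1 (d2 u) q * h * h.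
Proof.
move=> h0 hu.
have inb s t : x <= s <= x + h -> y <= t <= y + h -> cbox x (x + h) y (y + h) (s, t).
  by move=> ? ?; split; rewrite /= in_itv.
have x0 : x <= x <= x + h by apply/andP; split; lra.
have x1 : x <= x + h <= x + h by apply/andP; split; lra.
have y0 : y <= y <= y + h by apply/andP; split; lra.
have y1 : y <= y + h <= y + h by apply/andP; split; lra.
have [|t|t /andP[t1 t2] Et] := @MVT_cc (fun t => u (x + h, t) - u (x, t))
  (fun t => d2 u (x + h, t) - d2 u (x, t)) y (y + h); first lra.
  move=> ht.
  have q1 : is_derive t 1 (fun t => u (x + h, t)) (d2 u (x + h, t)).
    apply/(is_derive_e2P u (x + h, t)); apply: derivable_is_d2.
    exact: (hu _ (inb _ _ x1 ht)).1.
  have q2 : is_derive t 1 (fun t => u (x, t)) (d2 u (x, t)).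
    apply/(is_derive_e2P u (x, t)); apply: derivable_is_d2.
    exact: (hu _ (inb _ _ x0 ht)).1.
  exact: is_deriveB.
have ht : y <= t <= y + h by rewrite !ltW.
have [|s|s /andP[s1 s2] Es] := @MVT_cc (fun s => d2 u (s, t))
  (fun s => d1 (d2 u) (s, t)) x (x + h); first lra.
  move=> hs; apply/(is_derive_e1P (d2 u) (s, t)).
  exact: derivable_is_d1 (hu (s, t) (inb _ _ hs ht)).2.
exists (s, t); first by apply: inb => //; rewrite !ltW.
have -> : d1 (d2 u) (s, t) * h * h = (d1 (d2 u) (s, t) * (x + h - x)) * h by ring.
by rewrite -Es; move: Et; rewrite (_ : y + h - y = h); [move=> <-; ring|ring].
Qed.

(** If the mixed derivatives differed at [p], continuity would keep each within half the gap of its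
    value on a small square, where the two evaluations of the second difference force a common
    value. Both mixed derivatives occur in the divergence of the stress tensor. *)
Lemma C2_d1d2 V u p : open V -> C2_on V u -> V p -> d1 (d2 u) p = d2 (d1 u) p.
Proof.
move=> oV hu Vp; apply/eqP/negPn/negP => neq.
pose e := `|d1 (d2 u) p - d2 (d1 u) p| / 2.
have e0 : 0 < e by rewrite divr_gt0// normr_gt0 subr_eq0.
have [_ _ _ _ [_ c21 c12 _]] := hu p Vp.
have N : nbhs p (V `&` [set q | `|d2 (d1 u) p - d2 (d1 u) q| < e] `&`
    [set q | `|d1 (d2 u) p - d1 (d2 u) q| < e]).
  apply: filterI; first apply: filterI; first exact: open_nbhs_nbhs.
    by move/cvgrPdist_lt : c21; exact.
  by move/cvgrPdist_lt : c12; exact.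
have [h h0 hN] := obox_nbhs N.
have sub q : cbox p.1 (p.1 + h) p.2 (p.2 + h) q ->
    cbox (p.1 - h) (p.1 + h) (p.2 - h) (p.2 + h) q.
  by move=> [/=]; rewrite !in_itv /= => /andP[? ?] /andP[? ?]; split;
    rewrite /= in_itv /=; apply/andP; split; lra.
have [q qb Eq] := @second_difference_d2d1 u p.1 p.2 h h0 (fun q qb =>
  let: And5 _ h1 _ (And4 _ h2 _ _) _ := hu q (hN q (sub q qb)).1.1 in conj h1.1 h2).
have [q' qb' Eq'] := @second_difference_d1d2 u p.1 p.2 h h0 (fun q qb =>
  let: And5 _ h1 _ (And4 _ _ h2 _) _ := hu q (hN q (sub q qb)).1.1 in conj h1.2 h2).
have [[_ /= n1] _] := hN q (sub q qb).
have [_ /= n2] := hN q' (sub q' qb').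
have key (A B C D : R) : C * h * h = D * h * h -> `|B - C| < e -> `|A - D| < e ->
    `|A - B| < e + e.
  move=> /(mulIf (lt0r_neq0 h0))/(mulIf (lt0r_neq0 h0)) CD BC AD.
  rewrite (_ : A - B = (A - D) - (B - C)); last by rewrite CD; ring.
  by apply: le_lt_trans (ler_normB _ _) _; exact: ltrD.
have := key _ _ _ _ (etrans (esym Eq) Eq') n1 n2.
by rewrite /e -splitr ltxx.
Qed.

End Schwarz.

(** * Integration by parts against bumps *)

Section IntegrationByParts.
Context {R : realType}.
Implicit Types (a b c d s t : R) (n : nat) (p : pl R) (V : set (pl R)).
Local Notation mu2 := (@mu2 R).
Local Notation mT := (measurableTypeR R * measurableTypeR R)%type.

Lemma integral_support (A S : set (pl R)) (f : pl R -> R) : S `<=` A ->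
  (forall p, A p -> ~ S p -> f p = 0) ->
  (\int[mu2]_(p in A) (f p)%:E = \int[mu2]_(p in S) (f p)%:E)%E.
Proof.
move=> SA f0; rewrite [LHS]integral_mkcond [RHS]integral_mkcond.
apply: eq_integral => p _; rewrite !patchE.
have [Sp|Sp] := pselect (S p); first by rewrite !mem_set//; exact: SA.
rewrite [X in _ = X]ifF; last by apply/negP => /set_mem.
by case: ifPn => // /set_mem Ap; rewrite f0.
Qed.

Lemma continuous_integrable_obox V (g : pl R -> R) a b c d : open V ->
  (forall p, V p -> {for p, continuous g}) -> cbox a b c d `<=` V ->
  mu2.-integrable (obox a b c d) (EFin \o g).
Proof.
move=> oV cg KV; have := continuous_integrable_cbox oV cg KV.
apply: integrableS; [exact: measurable_cbox|exact: measurable_obox|exact: obox_sub_cbox].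
Qed.

(** The integrand is [d1] of [w * bump2], which vanishes on the sides of the box. Both terms stay
    under one integral sign, which avoids sums in the extended reals. *)
Lemma bump2_ibp1 V (w : pl R -> R) n s t s' t' : open V -> s < t -> s' < t' ->
  cbox s t s' t' `<=` V ->
  (forall p, V p -> [/\ {for p, continuous w}, derivable w p (e1 R) &
     {for p, continuous (d1 w)}]) ->
  (\int[mu2]_(p in obox s t s' t')
    (d1 w p * bump2 n s t s' t' p + w p * d1 (bump2 n s t s' t') p)%:E = 0)%E.
Proof.
move=> oV st st' KV hw.
have dF p : V p -> is_derive p (e1 R) (fun q => w q * bump2 n s t s' t' q)
    (d1 w p * bump2 n s t s' t' p + w p * d1 (bump2 n s t s' t') p).
  move=> /hw[_ dw _]; rewrite d1_bump2.
  exact: is_derive_mul (derivable_is_d1 dw) (is_derive_bump2_e1 _ _ _ _ _ _).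
rewrite -[RHS](@integral_d1_eq0 _ V (fun q => w q * bump2 n s t s' t' q) s t s' t')//.
- rewrite -(@integral_support (cbox s t s' t')).
  + by apply: eq_integral => p /set_mem/KV Vp; rewrite (d1E (dF p Vp)).
  + exact: obox_sub_cbox.
  + by move=> p _ np; have [-> -> _] := bump2_out n (ltW st) (ltW st') np; rewrite !mulr0 addr0.
- move=> p Vp; split; first by case: (dF p Vp).
  have [cw _ cdw] := hw p Vp.
  have : {for p, continuous (fun q => d1 w q * bump2 n s t s' t' q +
      w q * d1 (bump2 n s t s' t') q)}.
    by apply: cvgD; apply: cvgM => //; [exact: continuous_bump2|exact: continuous_d1_bump2].
  by apply: (eq_continuous_open oV Vp) => q Vq; rewrite (d1E (dF q Vq)).
- by move=> y; rewrite /bump2 /= !(@bump_out _ _ s) ?mul0r ?mulr0 ?ltxx ?andbF// ltW.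
Qed.

Lemma bump2_ibp2 V (w : pl R -> R) n s t s' t' : open V -> s < t -> s' < t' ->
  cbox s t s' t' `<=` V ->
  (forall p, V p -> [/\ {for p, continuous w}, derivable w p (e2 R) &
     {for p, continuous (d2 w)}]) ->
  (\int[mu2]_(p in obox s t s' t')
    (d2 w p * bump2 n s t s' t' p + w p * d2 (bump2 n s t s' t') p)%:E = 0)%E.
Proof.
move=> oV st st' KV hw.
have dF p : V p -> is_derive p (e2 R) (fun q => w q * bump2 n s t s' t' q)
    (d2 w p * bump2 n s t s' t' p + w p * d2 (bump2 n s t s' t') p).
  move=> /hw[_ dw _]; rewrite d2_bump2.
  exact: is_derive_mul (derivable_is_d2 dw) (is_derive_bump2_e2 _ _ _ _ _ _).
rewrite -[RHS](@integral_d2_eq0 _ V (fun q => w q * bump2 n s t s' t' q) s t s' t')//.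
- rewrite -(@integral_support (cbox s t s' t')).
  + by apply: eq_integral => p /set_mem/KV Vp; rewrite (d2E (dF p Vp)).
  + exact: obox_sub_cbox.
  + by move=> p _ np; have [-> _ ->] := bump2_out n (ltW st) (ltW st') np; rewrite !mulr0 addr0.
- move=> p Vp; split; first by case: (dF p Vp).
  have [cw _ cdw] := hw p Vp.
  have : {for p, continuous (fun q => d2 w q * bump2 n s t s' t' q +
      w q * d2 (bump2 n s t s' t') q)}.
    by apply: cvgD; apply: cvgM => //; [exact: continuous_bump2|exact: continuous_d2_bump2].
  by apply: (eq_continuous_open oV Vp) => q Vq; rewrite (d2E (dF q Vq)).
- by move=> x; rewrite /bump2 /= !(@bump_out _ _ s') ?mulr0 ?ltxx ?andbF// ltW.
Qed.

End IntegrationByParts.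

(** * Agreement of the weak and the classical gradient *)

Section WeakGradient.
Context {R : realType}.
Implicit Types (a b c d s t : R) (n : nat) (p q : pl R) (O V : set (pl R)).
Implicit Types (u w : pl R -> R).
Local Notation mu2 := (@mu2 R).
Local Notation mT := (measurableTypeR R * measurableTypeR R)%type.

Lemma integralD_eq0 (S : set mT) (f1 f2 : mT -> R) : measurable S ->
  mu2.-integrable S (EFin \o f1) -> mu2.-integrable S (EFin \o f2) ->
  (\int[mu2]_(p in S) (f1 p + f2 p)%:E = 0)%E <->
  (\int[mu2]_(p in S) (f1 p)%:E = - \int[mu2]_(p in S) (f2 p)%:E)%E.
Proof.
move=> mS i1 i2.
have -> : (\int[mu2]_(p in S) (f1 p + f2 p)%:E =
    \int[mu2]_(p in S) (f1 p)%:E + \int[mu2]_(p in S) (f2 p)%:E)%E.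
  by rewrite -(integralD_EFin mS i1 i2); apply: eq_integral => p _.
have F1 := integrable_fin_num mS i1; have F2 := integrable_fin_num mS i2.
move: F1 F2 => /=; case: (integral _ _ _) => [x| |]//; case: (integral _ _ _) => [y| |]// _ _.
by split => [[/eqP]|[->]]; [rewrite addr_eq0 => /eqP ->|rewrite -EFinD addNr].
Qed.

(** The derivatives enter as functions [D1], [D2], so that explicit formulas fit: the identity
    serves for [u] in one component with zero in the other, for the gravity field and for the stress
    tensor. *)
Lemma bump2_divergence V w1 w2 D1 D2 n s t s' t' : open V -> s < t -> s' < t' ->
  cbox s t s' t' `<=` V ->
  (forall p, V p -> [/\ {for p, continuous w1}, is_derive p (e1 R) w1 (D1 p) &
     {for p, continuous D1}]) ->
  (forall p, V p -> [/\ {for p, continuous w2}, is_derive p (e2 R) w2 (D2 p) &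
     {for p, continuous D2}]) ->
  let phi := bump2 n s t s' t' in
  (\int[mu2]_(p in obox s t s' t') (w1 p * d1 phi p + w2 p * d2 phi p)%:E =
   - \int[mu2]_(p in obox s t s' t') ((D1 p + D2 p) * phi p)%:E)%E.
Proof.
move=> oV st st' KV h1 h2 phi.
have sV p : obox s t s' t' p -> V p by move=> /obox_sub_cbox /KV.
have mS := measurable_obox s t s' t'.
have c1 p : V p -> {for p, continuous (fun p => D1 p * phi p + w1 p * d1 phi p)}.
  move=> /h1[cw _ cD]; apply: cvgD; apply: cvgM; [exact: cD| |exact: cw|].
    exact: continuous_bump2.
  exact: continuous_d1_bump2.
have c2 p : V p -> {for p, continuous (fun p => D2 p * phi p + w2 p * d2 phi p)}.
  move=> /h2[cw _ cD]; apply: cvgD; apply: cvgM; [exact: cD| |exact: cw|].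
    exact: continuous_bump2.
  exact: continuous_d2_bump2.
have I1 : (\int[mu2]_(p in obox s t s' t') (D1 p * phi p + w1 p * d1 phi p)%:E = 0)%E.
  rewrite -[RHS](@bump2_ibp1 _ V w1 n s t s' t')//.
    by apply: eq_integral => p /set_mem/sV/h1[_ d _]; rewrite (d1E d).
  move=> p Vp; have [cw [dw _] cD] := h1 p Vp; split => //.
  by apply: (eq_continuous_open oV Vp) cD => q /h1[_ d _]; rewrite (d1E d).
have I2 : (\int[mu2]_(p in obox s t s' t') (D2 p * phi p + w2 p * d2 phi p)%:E = 0)%E.
  rewrite -[RHS](@bump2_ibp2 _ V w2 n s t s' t')//.
    by apply: eq_integral => p /set_mem/sV/h2[_ d _]; rewrite (d2E d).
  move=> p Vp; have [cw [dw _] cD] := h2 p Vp; split => //.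
  by apply: (eq_continuous_open oV Vp) cD => q /h2[_ d _]; rewrite (d2E d).
have i1 := continuous_integrable_obox oV c1 KV.
have i2 := continuous_integrable_obox oV c2 KV.
have c3 p : V p -> {for p, continuous (fun p => w1 p * d1 phi p + w2 p * d2 phi p)}.
  move=> Vp; have [c3 _ _] := h1 p Vp; have [c4 _ _] := h2 p Vp.
  apply: cvgD; apply: cvgM; [exact: c3| |exact: c4|].
    exact: continuous_d1_bump2.
  exact: continuous_d2_bump2.
have c4 p : V p -> {for p, continuous (fun p => (D1 p + D2 p) * phi p)}.
  move=> Vp; have [_ _ c3'] := h1 p Vp; have [_ _ c4'] := h2 p Vp.
  by apply: cvgM; [apply: cvgD; [exact: c3'|exact: c4']|exact: continuous_bump2].
have i3 := continuous_integrable_obox oV c3 KV.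
have i4 := continuous_integrable_obox oV c4 KV.
apply/(integralD_eq0 mS i3 i4).
have I12 := (integralD_eq0 mS i1 i2).2.
rewrite I1 I2 oppe0 in I12.
rewrite -[RHS](I12 erefl).
by apply: eq_integral => p _; congr EFin; ring.
Qed.

(** A box has finite measure, and [|g| <= 1 + g^2]. *)
Lemma L2_integrable_obox O (g : pl R -> R) a b c d : open O -> L2 O g ->
  obox a b c d `<=` O -> mu2.-integrable (obox a b c d) (EFin \o g).
Proof.
move=> oO [mg ig] SO; have mS := measurable_obox a b c d.
have mO : measurable (O : set mT) by exact: open_measurable_pl.
have i1 : mu2.-integrable (obox a b c d) (EFin \o (cst 1 : pl R -> R)).
  apply: (@continuous_integrable_obox _ setT); [exact: openT| |exact: subsetT].
  by move=> p _; exact: cvg_cst.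
have i2 : mu2.-integrable (obox a b c d) (EFin \o (fun p => g p ^+ 2)).
  exact: (integrableS mO mS SO ig).
have i3 := integrableD mS i1 i2.
apply: (le_integrable mS _ _ i3).
  by apply/measurable_EFinP; exact: measurable_funS SO mg.
move=> p _ /=; rewrite ?abse_EFin lee_fin [leRHS]ger0_norm ?addr_ge0 ?sqr_ge0//.
by rewrite -real_normK ?num_real//; have := normr_ge0 (g p); nra.
Qed.

(** [fundamental_lemma] is applied to [g - G]: square integrability of [g] and continuity of [G]
    around the closed box make both terms integrable, so the two tested integrals may be
    subtracted. *)
Lemma ae_eq_bump2 O V (g G : pl R -> R) a b c d : open O -> open V -> V `<=` O ->
  L2 O g -> (forall p, V p -> {for p, continuous G}) -> cbox a b c d `<=` V ->
  (forall n s t s' t', s < t -> s' < t' -> cbox s t s' t' `<=` V ->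
    (\int[mu2]_(p in O) (g p * bump2 n s t s' t' p)%:E =
     \int[mu2]_(p in obox s t s' t') (G p * bump2 n s t s' t' p)%:E)%E) ->
  ae_eq mu2 (obox a b c d) (EFin \o g) (EFin \o G).
Proof.
move=> oO oV VO Lg cG KV gG.
have mK := measurable_obox a b c d.
have sO : obox a b c d `<=` O by move=> p /obox_sub_cbox /KV /VO.
have ig := L2_integrable_obox oO Lg sO.
have iG := continuous_integrable_obox oV cG KV.
have : ae_eq mu2 (obox a b c d) (EFin \o (fun p => g p - G p)) (cst 0%E).
  apply: fundamental_lemma; first exact: (integrableB mK ig iG).
  move=> n s t s' t' as_ st tb cs st' td.
  have sK : cbox s t s' t' `<=` cbox a b c d.
    by move=> p [/=]; rewrite !in_itv /= => /andP[? ?] /andP[? ?]; split;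
      rewrite /= in_itv /=; apply/andP; split; lra.
  have SK : obox s t s' t' `<=` obox a b c d.
    by move=> p [/=]; rewrite !in_itv /= => /andP[? ?] /andP[? ?]; split;
      rewrite /= in_itv /=; apply/andP; split; lra.
  have KV' := subset_trans sK KV.
  have mS := measurable_obox s t s' t'.
  have bo p : ~ obox s t s' t' p -> _ := bump2_out n (ltW st) (ltW st').
  have := gG n s t s' t' st st' KV'.
  rewrite (@integral_support _ O (obox s t s' t')); last 2 first.
  - exact: subset_trans SK sO.
  - by move=> p _ /bo[-> _ _]; rewrite mulr0.
  move=> E.
  rewrite (@integral_support _ (obox a b c d) (obox s t s' t') _ SK); last first.
    by move=> p _ /bo[-> _ _]; rewrite mulr0.
  have cphi p : V p -> {for p, continuous (fun p => G p * bump2 n s t s' t' p)}.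
    by move=> /cG cGp; apply: cvgM; [exact: cGp|exact: continuous_bump2].
  have i2 := continuous_integrable_obox oV cphi KV'.
  have igS := integrableS mK mS SK ig.
  have i1 : mu2.-integrable (obox s t s' t') (EFin \o (fun p => g p * bump2 n s t s' t' p)).
    apply: (le_integrable mS _ _ igS).
      apply/measurable_EFinP; apply: measurable_funM.
        by case/integrableP: igS => /measurable_EFinP.
      apply: (@measurable_funS _ _ _ _ setT); [exact: measurableT|exact: subsetT|].
      by apply: continuous_measurable_pl; [exact: openT|move=> p _; exact: continuous_bump2].
    move=> p _ /=; rewrite ?abse_EFin lee_fin normrM ler_piMr//.
    rewrite ger0_norm; first by rewrite mulr_ile1 ?bump_ge0 ?bump_le1.
    by rewrite mulr_ge0 ?bump_ge0.
  rewrite (_ : integral _ _ _ = (\int[mu2]_(p in obox s t s' t')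
    ((g p * bump2 n s t s' t' p)%:E - (G p * bump2 n s t s' t' p)%:E))%E); last first.
    by apply: eq_integral => p _; rewrite -EFinB; congr EFin; ring.
  by rewrite (integralB_EFin mS i1 i2) E subee// (integrable_fin_num mS i2).
apply: filterS => p /= h Kp; have /eqP := h Kp.
by rewrite eqe subr_eq0 => /eqP ->.
Qed.

Lemma weak_grad_ae1 O V u g1 g2 a b c d : open O -> open V -> V `<=` O ->
  L2 O g1 -> weak_grad O u g1 g2 ->
  (forall p, V p -> [/\ {for p, continuous u}, derivable u p (e1 R) &
     {for p, continuous (d1 u)}]) ->
  cbox a b c d `<=` V ->
  ae_eq mu2 (obox a b c d) (EFin \o g1) (EFin \o d1 u).
Proof.
move=> oO oV VO Lg wg hu KV.
apply: (ae_eq_bump2 oO oV VO Lg _ KV) => [p /hu[]//|n s t s' t' st st' KV'].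
have bo p : ~ obox s t s' t' p -> _ := bump2_out n (ltW st) (ltW st').
have [+ _] := wg _ (bump2_C1c n (ltW st) (ltW st') (subset_trans KV' VO)).
rewrite (@integral_support _ O (obox s t s' t')); last 2 first.
- by move=> p /obox_sub_cbox /KV' /VO.
- by move=> p _ /bo[_ -> _]; rewrite mulr0.
move=> /(congr1 (fun z => - z)%E); rewrite oppeK => <-.
have h1 p : V p -> [/\ {for p, continuous u}, is_derive p (e1 R) u (d1 u p) &
    {for p, continuous (d1 u)}].
  by move=> /hu[cu du cdu]; split; [exact: cu|exact: derivable_is_d1|exact: cdu].
(* A zero second component turns the divergence identity into integration by parts in the first
   direction. *)
have h2 p : V p -> [/\ {for p, continuous (cst 0 : pl R -> R)},
    is_derive p (e2 R) (cst 0 : pl R -> R) ((cst 0 : pl R -> R) p) &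
    {for p, continuous (cst 0 : pl R -> R)}].
  by move=> _; split; [exact: cvg_cst|exact: is_derive_cst|exact: cvg_cst].
have /= E := bump2_divergence n oV st st' KV' h1 h2.
transitivity (- \int[mu2]_(p in obox s t s' t')
   (u p * d1 (bump2 n s t s' t') p + 0 * d2 (bump2 n s t s' t') p)%:E)%E.
  by congr (- _)%E; apply: eq_integral => p _; rewrite mul0r addr0.
by rewrite E oppeK; apply: eq_integral => p _; rewrite addr0.
Qed.

Lemma weak_grad_ae2 O V u g1 g2 a b c d : open O -> open V -> V `<=` O ->
  L2 O g2 -> weak_grad O u g1 g2 ->
  (forall p, V p -> [/\ {for p, continuous u}, derivable u p (e2 R) &
     {for p, continuous (d2 u)}]) ->
  cbox a b c d `<=` V ->
  ae_eq mu2 (obox a b c d) (EFin \o g2) (EFin \o d2 u).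
Proof.
move=> oO oV VO Lg wg hu KV.
apply: (ae_eq_bump2 oO oV VO Lg _ KV) => [p /hu[]//|n s t s' t' st st' KV'].
have bo p : ~ obox s t s' t' p -> _ := bump2_out n (ltW st) (ltW st').
have [_] := wg _ (bump2_C1c n (ltW st) (ltW st') (subset_trans KV' VO)).
rewrite (@integral_support _ O (obox s t s' t')); last 2 first.
- by move=> p /obox_sub_cbox /KV' /VO.
- by move=> p _ /bo[_ _ ->]; rewrite mulr0.
move=> /(congr1 (fun z => - z)%E); rewrite oppeK => <-.
have h2 p : V p -> [/\ {for p, continuous u}, is_derive p (e2 R) u (d2 u p) &
    {for p, continuous (d2 u)}].
  by move=> /hu[cu du cdu]; split; [exact: cu|exact: derivable_is_d2|exact: cdu].
have h1 p : V p -> [/\ {for p, continuous (cst 0 : pl R -> R)},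
    is_derive p (e1 R) (cst 0 : pl R -> R) ((cst 0 : pl R -> R) p) &
    {for p, continuous (cst 0 : pl R -> R)}].
  by move=> _; split; [exact: cvg_cst|exact: is_derive_cst|exact: cvg_cst].
have /= E := bump2_divergence n oV st st' KV' h1 h2.
transitivity (- \int[mu2]_(p in obox s t s' t')
   (0 * d1 (bump2 n s t s' t') p + u p * d2 (bump2 n s t s' t') p)%:E)%E.
  by congr (- _)%E; apply: eq_integral => p _; rewrite mul0r add0r.
by rewrite E oppeK; apply: eq_integral => p _; rewrite add0r.
Qed.

End WeakGradient.

(** * The domain variation inside {u < 0} *)

Section DomainVariation.
Context {R : realType}.
Implicit Types (a b c d s t : R) (n : nat) (p q : pl R) (O V : set (pl R)).
Implicit Types (u w : pl R -> R).
Local Notation mu2 := (@mu2 R).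
Local Notation mT := (measurableTypeR R * measurableTypeR R)%type.

(** Otherwise [h] would be nonzero on a whole box around [p], which has positive measure. *)
Lemma ae_eq0_continuous (h : pl R -> R) a b c d p : obox a b c d p ->
  {for p, continuous h} -> ae_eq mu2 (obox a b c d) (EFin \o h) (cst 0%E) -> h p = 0.
Proof.
move=> Kp ch [N [mN N0 sub]]; apply/eqP/negPn/negP => hp.
have : nbhs p (obox a b c d `&` [set q | `|h p - h q| < `|h p|]).
  apply: filterI; first by apply: open_nbhs_nbhs; split => //; exact: open_obox.
  by move/cvgrPdist_lt : ch; apply; rewrite normr_gt0.
move=> /obox_nbhs[e e0 eN].
have sN : obox (p.1 - e) (p.1 + e) (p.2 - e) (p.2 + e) `<=` N.
  move=> q /obox_sub_cbox /eN[Kq /= hq]; apply: sub => /= /(_ Kq)[hq0].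
  by move: hq; rewrite hq0 subr0 ltxx.
have := @mu2_obox_gt0 R (p.1 - e) (p.1 + e) (p.2 - e) (p.2 + e) ltac:(lra) ltac:(lra).
apply/negP; rewrite -leNgt -N0; apply: le_measure => //; rewrite inE.
- exact: measurable_obox.
- exact: mN.
Qed.

Lemma is_deriveZ_pl (k : R) (f : pl R -> R) p v l : is_derive p v f l ->
  is_derive p v (fun q => k * f q) (k * l).
Proof.
move=> hf; have := is_derive_mul (is_derive_cst k p v) hf.
by rewrite mul0r add0r.
Qed.

Lemma C1c_scale O (k : R) (f : pl R -> R) : C1c O f -> C1c O (fun q => k * f q).
Proof.
move=> [[df [cf [c1 c2]]] [cpt sub]].
have E1 : d1 (fun q => k * f q) = (fun q => k * d1 f q).
  by apply/funext => q; apply/d1E/is_deriveZ_pl/derivable_is_d1; exact: (df q).1.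
have E2 : d2 (fun q => k * f q) = (fun q => k * d2 f q).
  by apply/funext => q; apply/d2E/is_deriveZ_pl/derivable_is_d2; exact: (df q).2.
have cM (g : pl R -> R) : continuous g -> continuous (fun q => k * g q).
  by move=> cg q; apply: cvgM; [exact: cvg_cst|exact: cg].
have sup : closure [set x | k * f x != 0] `<=` closure [set x | f x != 0].
  by apply: closure_subset => x /=; rewrite mulf_eq0 negb_or => /andP[].
split; last split.
- split; first move=> q; first split.
  + by case: (is_deriveZ_pl k (derivable_is_d1 (df q).1)).
  + by case: (is_deriveZ_pl k (derivable_is_d2 (df q).2)).
  rewrite E1 E2; split; first exact: cM.
  by split; exact: cM.
- by apply: subclosed_compact cpt sup; exact: closed_closure.
- exact: subset_trans sup sub.
Qed.

(** Exchanging [al] with [be] and [f1] with [f2] turns the first component of the stress into the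
    second, so one formula serves for both directions. *)
Lemma stress_divergence (al be : R) (f1 f2 : pl R -> R) p v l1 l2 :
  is_derive p v f1 l1 -> is_derive p v f2 l2 ->
  is_derive p v (fun q => al * (f2 q * f2 q - f1 q * f1 q) - 2 * be * (f1 q * f2 q))
    (al * (2 * (f2 p * l2) - 2 * (f1 p * l1)) - 2 * be * (l1 * f2 p + f1 p * l2)).
Proof.
move=> h1 h2.
have m11 := is_derive_mul h1 h1; have m22 := is_derive_mul h2 h2.
have m12 := is_derive_mul h1 h2.
have := is_deriveB (is_deriveZ_pl al (is_deriveB m22 m11)) (is_deriveZ_pl (2 * be) m12).
move=> h; apply: (is_derive_eq h); ring.
Qed.

Lemma continuous_stress (al be : R) (f1 f2 : pl R -> R) p :
  {for p, continuous f1} -> {for p, continuous f2} ->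
  {for p, continuous (fun q => al * (f2 q * f2 q - f1 q * f1 q) - 2 * be * (f1 q * f2 q))}.
Proof.
move=> c1 c2; apply: cvgB; apply: cvgM; try exact: cvg_cst; last exact: cvgM.
by apply: cvgB; exact: cvgM.
Qed.

Lemma continuous_stress_divergence (al be : R) (f1 f2 l1 l2 : pl R -> R) p :
  {for p, continuous f1} -> {for p, continuous f2} ->
  {for p, continuous l1} -> {for p, continuous l2} ->
  {for p, continuous (fun q => al * (2 * (f2 q * l2 q) - 2 * (f1 q * l1 q))
    - 2 * be * (l1 q * f2 q + f1 q * l2 q))}.
Proof.
move=> c1 c2 c3 c4; apply: cvgB; apply: cvgM; try exact: cvg_cst.
  by apply: cvgB; apply: cvgM; try exact: cvg_cst; exact: cvgM.
by apply: cvgD; exact: cvgM.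
Qed.

Section Laplacian.
Variables (O V : set (pl R)) (x20 : R) (u g1 g2 : pl R -> R).
Hypotheses (oO : open O) (oV : open V) (VO : V `<=` O).
Hypothesis Vneg : forall p, V p -> u p < 0.
Hypothesis Vlow : forall p, V p -> p.2 < x20.
Hypothesis uC2 : C2_on V u.
Hypothesis uW12 : W12 O u g1 g2.
Hypothesis uvar : forall p1 p2 : pl R -> R, C1c O p1 -> C1c O p2 -> weak_identity O x20 u g1 g2 p1 p2.

Let u1 := d1 u.
Let u2 := d2 u.

(** [S1] and [S2] are the coefficients of [d1 phi] and [d2 phi] in the first integrand of (ii) for
    the field [(al * phi, be * phi)]. *)
Let S1 al be p := al * (u2 p * u2 p - u1 p * u1 p) - 2 * be * (u1 p * u2 p).
Let S2 al be p := be * (u1 p * u1 p - u2 p * u2 p) - 2 * al * (u2 p * u1 p).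
Let D1 al be p := al * (2 * (u2 p * d1 u2 p) - 2 * (u1 p * d1 u1 p))
  - 2 * be * (d1 u1 p * u2 p + u1 p * d1 u2 p).
Let D2 al be p := be * (2 * (u1 p * d2 u1 p) - 2 * (u2 p * d2 u2 p))
  - 2 * al * (d2 u2 p * u1 p + u2 p * d2 u1 p).

Let S1_reg al be p : V p -> [/\ {for p, continuous (S1 al be)},
  is_derive p (e1 R) (S1 al be) (D1 al be p) & {for p, continuous (D1 al be)}].
Proof.
move=> /uC2[c _ [c1 c2] [d11 d12 d21 d22] [c11 c12 c21 c22]]; split.
- exact: (continuous_stress c1 c2).
- exact: (stress_divergence al be (derivable_is_d1 d11) (derivable_is_d1 d21)).
- exact: (continuous_stress_divergence c1 c2 c11 c21).
Qed.

Let S2_reg al be p : V p -> [/\ {for p, continuous (S2 al be)},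
  is_derive p (e2 R) (S2 al be) (D2 al be p) & {for p, continuous (D2 al be)}].
Proof.
move=> /uC2[c _ [c1 c2] [d11 d12 d21 d22] [c11 c12 c21 c22]]; split.
- exact: (continuous_stress c2 c1).
- exact: (stress_divergence be al (derivable_is_d2 d22) (derivable_is_d2 d12)).
- exact: (continuous_stress_divergence c2 c1 c22 c12).
Qed.

(* The gravity term of the domain variation is an exact divergence below the
   level [x20], so only the stress tensor of [u] contributes. *)
Lemma stress_bump2_eq0 al be n s t s' t' : s < t -> s' < t' -> cbox s t s' t' `<=` V ->
  (\int[mu2]_(p in obox s t s' t') (S1 al be p * d1 (bump2 n s t s' t') p +
     S2 al be p * d2 (bump2 n s t s' t') p)%:E = 0)%E.
Proof.
move=> st st' KV; set phi := bump2 n s t s' t'; set S := obox s t s' t'.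
have mS : measurable (S : set mT) by exact: measurable_obox.
have SV p : S p -> V p by move=> /obox_sub_cbox /KV.
have SO p : S p -> O p by move=> /SV /VO.
have bo p : ~ S p -> [/\ phi p = 0, d1 phi p = 0 & d2 phi p = 0].
  exact: (bump2_out n (ltW st) (ltW st')).
have C : C1c O phi := bump2_C1c n (ltW st) (ltW st') (subset_trans KV VO).
have [Lu Lg1 Lg2 wg] := uW12.
have E1 k p : d1 (fun q => k * phi q) p = k * d1 phi p.
  by apply/d1E/is_deriveZ_pl/derivable_is_d1; exact: (C.1.1 p).1.
have E2 k p : d2 (fun q => k * phi q) p = k * d2 phi p.
  by apply/d2E/is_deriveZ_pl/derivable_is_d2; exact: (C.1.1 p).2.
have := uvar (C1c_scale al C) (C1c_scale be C); rewrite /weak_identity /=.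
have I3 : (\int[mu2]_(x in O `&` [set y | (y.2 > x20)%R])
   ((x.2 - x20) * chi R (u x > 0) * (d1 (fun q => al * phi q) x + d2 (fun q => be * phi q) x)
     + chi R (u x > 0) * (be * phi x))%R%:E = 0)%E.
  apply: integral0_eq => x _; rewrite E1 E2.
  have [Sx|/bo[-> -> ->]] := pselect (S x); last by congr EFin; ring.
  by rewrite lt_gtF; [rewrite /chi /= mulr0 !mul0r addr0|exact/Vneg/SV].
have I2 : (\int[mu2]_(x in O `&` [set y | (y.2 < x20)%R])
   ((x20 - x.2) * chi R (u x < 0) * (d1 (fun q => al * phi q) x + d2 (fun q => be * phi q) x)
     - chi R (u x < 0) * (be * phi x))%R%:E = 0)%E.
  rewrite (@integral_support _ _ S); last 2 first.
  - by move=> p Sp; split; [exact: SO|apply: Vlow; exact: SV].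
  - by move=> p _ /bo[-> e1 e2]; rewrite E1 E2 e1 e2; ring.
  (* This field has divergence [- be], so integrating it by parts against [phi] produces exactly the
     term [- be * phi]. *)
  pose w1 p := al * (x20 - p.2); pose w2 p := be * (x20 - p.2).
  have cw p k : {for p, continuous (fun p : pl R => k * (x20 - p.2))}.
    by apply: cvgM; [exact: cvg_cst|apply: cvgB; [exact: cvg_cst|exact: cvg_snd]].
  have h1 p : V p -> [/\ {for p, continuous w1}, is_derive p (e1 R) w1 ((cst 0 : pl R -> R) p)
      & {for p, continuous (cst 0 : pl R -> R)}].
    move=> _; split; [exact: cw| |exact: cvg_cst].
    by apply/is_derive_e1P; rewrite /w1 /=; exact: is_derive_cst.
  have h2 p : V p -> [/\ {for p, continuous w2}, is_derive p (e2 R) w2 ((cst (- be) : pl R -> R) p)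
      & {for p, continuous (cst (- be) : pl R -> R)}].
    move=> _; split; [exact: cw| |exact: cvg_cst].
    by apply/is_derive_e2P; rewrite /w2 /=; apply: is_derive_eq; rewrite /GRing.scale /=; ring.
  have /= E := bump2_divergence n oV st st' KV h1 h2.
  have iphi : mu2.-integrable S (EFin \o (fun p => (0 - be) * phi p)).
    apply: (continuous_integrable_obox oV _ KV) => p _.
    by apply: cvgM; [exact: cvg_cst|exact: continuous_bump2].
  have iw : mu2.-integrable S (EFin \o (fun p => w1 p * d1 phi p + w2 p * d2 phi p)).
    apply: (continuous_integrable_obox oV _ KV) => p _.
    apply: cvgD; apply: cvgM; [exact: cw| |exact: cw|].
      exact: continuous_d1_bump2.
    exact: continuous_d2_bump2.
  have I := (integralD_eq0 mS iw iphi).2 E.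
  rewrite -[RHS]I; apply: eq_integral => p /set_mem Sp; rewrite E1 E2 /chi (Vneg (SV _ Sp)).
  by congr EFin; rewrite /w1 /w2 /= mulr1n; ring.
rewrite I2 I3 !adde0.
rewrite (@integral_support _ _ S); last 2 first.
- exact: SO.
- by move=> p _ /bo[_ e1 e2]; rewrite !E1 !E2 e1 e2; ring.
have reg1 p : V p -> [/\ {for p, continuous u}, derivable u p (e1 R) &
    {for p, continuous (d1 u)}] by move=> /uC2[? [? _] [? _] _ _].
have reg2 p : V p -> [/\ {for p, continuous u}, derivable u p (e2 R) &
    {for p, continuous (d2 u)}] by move=> /uC2[? [_ ?] [_ ?] _ _].
have A1 := weak_grad_ae1 oO oV VO Lg1 wg reg1 KV.
have A2 := weak_grad_ae2 oO oV VO Lg2 wg reg2 KV.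
have mphi1 : measurable_fun (S : set mT) (d1 phi : mT -> R).
  apply: (@measurable_funS _ _ _ _ setT); [exact: measurableT|exact: subsetT|].
  by apply: continuous_measurable_pl; [exact: openT|move=> p _; exact: continuous_d1_bump2].
have mphi2 : measurable_fun (S : set mT) (d2 phi : mT -> R).
  apply: (@measurable_funS _ _ _ _ setT); [exact: measurableT|exact: subsetT|].
  by apply: continuous_measurable_pl; [exact: openT|move=> p _; exact: continuous_d2_bump2].
have mOO : measurable (O : set mT) by exact: open_measurable_pl.
have mg1 : measurable_fun (S : set mT) (g1 : mT -> R) by exact: measurable_funS mOO SO Lg1.1.
have mg2 : measurable_fun (S : set mT) (g2 : mT -> R) by exact: measurable_funS mOO SO Lg2.1.
(* The integrand as a function of the gradient values, so that the weak gradient can be exchanged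
   for the classical one almost everywhere. *)
pose Q (y1 y2 : R) (p : pl R) := (al * (y2 * y2 - y1 * y1) - 2 * be * (y1 * y2)) * d1 phi p
  + (be * (y1 * y1 - y2 * y2) - 2 * al * (y2 * y1)) * d2 phi p.
move=> I1; have I1' : (\int[mu2]_(p in S) (Q (g1 p) (g2 p) p)%:E = 0)%E.
  by rewrite [RHS]I1; apply: eq_integral => p _; congr EFin; rewrite !E1 !E2 /Q; ring.
have mQ (f1 f2 : mT -> R) : measurable_fun S f1 -> measurable_fun S f2 ->
    measurable_fun S (fun p => (Q (f1 p) (f2 p) p)%:E).
  move=> m1 m2; apply/measurable_EFinP; apply: measurable_funD.
    apply: measurable_funM => //; apply: measurable_funB; apply: measurable_funM => //.
      by apply: measurable_funB; exact: measurable_funM.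
    exact: measurable_funM.
  apply: measurable_funM => //; apply: measurable_funB; apply: measurable_funM => //.
    by apply: measurable_funB; exact: measurable_funM.
  exact: measurable_funM.
rewrite -[RHS]I1'; apply: ae_eq_integral; first exact: mS.
- apply: mQ.
    apply: measurable_funS (open_measurable_pl oV) SV _.
    by apply: continuous_measurable_pl => // p /reg1[].
  apply: measurable_funS (open_measurable_pl oV) SV _.
  by apply: continuous_measurable_pl => // p /reg2[].
- exact: mQ.
- apply: filterS2 A1 A2 => p /= h1 h2 Sp.
  by have [->] := h1 Sp; have [->] := h2 Sp.
Qed.

(** The direction [(al, be)] is frozen at the gradient of [u] at [p]. At a general point [D1 + D2]
    equals -2 Lap u times [al * d1 u + be * d2 u]; it is continuous and orthogonal to all bumps,
    hence zero, and at [p] the last factor is |grad u|^2. *)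
Lemma grad_laplacian_eq0 p : V p ->
  (d1 u p ^+ 2 + d2 u p ^+ 2) * (d1 (d1 u) p + d2 (d2 u) p) = 0.
Proof.
move=> Vp; have [e e0 KV] := obox_nbhs (open_nbhs_nbhs (conj oV Vp)).
set a := p.1 - e in KV; set b := p.1 + e in KV; set c := p.2 - e in KV; set d := p.2 + e in KV.
pose al := d1 u p; pose be := d2 u p.
have cD q : V q -> {for q, continuous (fun q => D1 al be q + D2 al be q)}.
  move=> Vq; have [_ _ cD1] := S1_reg al be Vq; have [_ _ cD2] := S2_reg al be Vq.
  by apply: cvgD; [exact: cD1|exact: cD2].
have A : ae_eq mu2 (obox a b c d) (EFin \o (fun q => D1 al be q + D2 al be q)) (cst 0%E).
  apply: fundamental_lemma; first exact: (continuous_integrable_obox oV cD KV).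
  move=> n s t s' t' as_ st tb cs st' td.
  have sK : cbox s t s' t' `<=` cbox a b c d.
    by move=> q [/=]; rewrite !in_itv /= => /andP[? ?] /andP[? ?]; split;
      rewrite /= in_itv /=; apply/andP; split; lra.
  have SK : obox s t s' t' `<=` obox a b c d.
    by move=> q [/=]; rewrite !in_itv /= => /andP[? ?] /andP[? ?]; split;
      rewrite /= in_itv /=; apply/andP; split; lra.
  rewrite (@integral_support _ _ _ _ SK); last first.
    by move=> q _ /(bump2_out n (ltW st) (ltW st'))[-> _ _]; rewrite mulr0.
  have KV' := subset_trans sK KV.
  have /= E := bump2_divergence n oV st st' KV' (@S1_reg al be) (@S2_reg al be).
  have /= I0 := stress_bump2_eq0 al be n st st' KV'.
  by move/esym: E; rewrite I0 => /eqP; rewrite oppe_eq0 => /eqP.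
have Kp : obox a b c d p by split; rewrite /= in_itv /=; apply/andP; split; rewrite /a /b /c /d; lra.
have := ae_eq0_continuous Kp (cD p Vp) A.
rewrite /D1 /D2 /u1 /u2 (C2_d1d2 oV uC2 Vp) -/al -/be => h.
move: h; move: (d1 (d1 u) p) (d2 (d2 u) p) (d2 (d1 u) p) => x y z h.
by apply: (mulfI (_ : (- 2 : R) != 0)); [rewrite oppr_eq0 pnatr_eq0|rewrite mulr0 -[RHS]h; ring].
Qed.

End Laplacian.
End DomainVariation.

(** * Hopf's boundary point argument *)

Section Hopf.
Context {R : realType}.
Implicit Types (p q : pl R) (V : set (pl R)) (u : pl R -> R).

(** The second derivative is assumed at [x] alone: if it were positive, [df] would be positive just
    to the right of [x], and the mean value theorem would raise [f] above its maximum. *)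
Lemma local_max_test (f df : R -> R) (x l r : R) : 0 < r ->
  (forall t, `|t - x| < r -> is_derive t 1 f (df t)) -> is_derive x 1 df l ->
  (forall t, `|t - x| < r -> f t <= f x) -> df x = 0 /\ l <= 0.
Proof.
move=> r0 hf hdf fmax.
have near_r t : t \in `](x - r), (x + r)[ -> `|t - x| < r.
  by rewrite in_itv /= => /andP[? ?]; rewrite ltr_norml; apply/andP; split; lra.
have df0 : df x = 0.
  have hx : is_derive x 1 f 0.
    apply: (@derive1_at_max _ f (x - r) (x + r) x); first lra.
    - by move=> t /near_r/hf[].
    - by rewrite in_itv /=; apply/andP; split; lra.
    - by move=> t /near_r; exact: fmax.
  have hx' : is_derive x 1 f (df x) by apply: hf; rewrite subrr normr0.
  by case: hx => _ <-; case: hx' => _ <-.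
split=> //; rewrite leNgt; apply/negP => l0.
have [ddf dfl] := hdf.
have : \forall h \near (0 : R)^', 0 < h^-1 *: ((df \o shift x) (h *: (1 : R)) - df x).
  by apply: (cvgr_gt _ ddf); rewrite -[lim _]/('D_1 df x) dfl.
move=> /nbhs_ballP[e /= e0 he].
pose h := Num.min e r / 2.
have h0 : 0 < h by rewrite divr_gt0// lt_min e0.
have hle : h < e /\ h < r.
  have : Num.min e r <= e /\ Num.min e r <= r by rewrite !ge_min !lexx orbT.
  have : 0 < Num.min e r by rewrite lt_min e0.
  by rewrite /h => ? [? ?]; split; lra.
have [|t|t /andP[t1 t2] E] := @MVT_cc _ f df x (x + h); first lra.
  move=> /andP[? ?]; apply: hf; rewrite ltr_norml; apply/andP; split; lra.
have : f (x + h) <= f x.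
  apply: fmax; rewrite (_ : x + h - x = h); last ring.
  by rewrite gtr0_norm//; case: hle.
apply/negP; rewrite -ltNge -subr_gt0 E (_ : x + h - x = h); last ring.
rewrite pmulr_lgt0//.
have := he (t - x); rewrite /= /ball /= sub0r normrN.
have tx : 0 < t - x by rewrite subr_gt0.
rewrite gtr0_norm// => /(_ _ (lt0r_neq0 tx)).
rewrite /GRing.scale /= mulr1 subrK df0 subr0 pmulr_rgt0 ?invr_gt0//; apply.
by case: hle => ? _; lra.
Qed.

Definition sqdist (c q : pl R) : R := (q.1 - c.1) ^+ 2 + (q.2 - c.2) ^+ 2.

Lemma continuous_sqdist c : continuous (sqdist c).
Proof.
move=> q; rewrite /sqdist; under eq_fun do rewrite !expr2.
by apply: cvgD; apply: cvgM; apply: cvgB;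
  try exact: cvg_cst; try exact: cvg_fst; exact: cvg_snd.
Qed.

Lemma compact_annulus c (a b : R) : compact [set q | a <= sqdist c q <= b ^+ 2].
Proof.
(* [b] may have either sign, so the enclosing square has half-side [|b|]. *)
apply: (@subclosed_compact _ _ (cbox (c.1 - `|b|) (c.1 + `|b|) (c.2 - `|b|) (c.2 + `|b|))).
- rewrite (_ : [set q | _] = sqdist c @^-1` `[a, b ^+ 2]%classic); last first.
    by apply/seteqP; split => q /=; rewrite in_itv.
  apply: closed_comp; last exact: interval_closed.
  by move=> q _; exact: continuous_sqdist.
- exact: compact_cbox.
- move=> q /= /andP[_]; rewrite /sqdist -(real_normK (num_real b)) => h.
  have key (z : R) : z ^+ 2 <= `|b| ^+ 2 -> - `|b| <= z <= `|b|.
    by rewrite -ler_norml -[z ^+ 2](real_normK (num_real z)) ler_pXn2r ?nnegrE.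
  have [] : (q.1 - c.1) ^+ 2 <= `|b| ^+ 2 /\ (q.2 - c.2) ^+ 2 <= `|b| ^+ 2.
    by have := sqr_ge0 (q.1 - c.1); have := sqr_ge0 (q.2 - c.2); split; lra.
  move=> /key/andP[? ?] /key/andP[? ?].
  by split; rewrite /= in_itv /=; apply/andP; split; lra.
Qed.

(** With s = [sqdist c q] and r = [rho ^+ 2] this is 3 r^2 - 5 r s + 2 s^2. It vanishes on the
    circle s = r; its s-derivative 4 s - 5 r is negative for s <= r, so the centre is its only
    critical point in the disc; its planar Laplacian 32 s - 20 r is positive for s > 5 r / 8, which
    leaves room for the inner bound 3 r / 4. It replaces the usual exponential barrier. *)
Definition barrier c (rho : R) q :=
  (rho ^+ 2 - sqdist c q) * (3 * rho ^+ 2 - 2 * sqdist c q).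

Lemma is_derive_sqdist1 c (y t : R) :
  is_derive t 1 (fun t => sqdist c (t, y)) (2 * (t - c.1)).
Proof.
rewrite /sqdist /=; apply: is_derive_eq; rewrite /GRing.scale /=; ring.
Qed.

Lemma is_derive_sqdist2 c (y t : R) :
  is_derive t 1 (fun t => sqdist c (y, t)) (2 * (t - c.2)).
Proof.
rewrite /sqdist /=; apply: is_derive_eq; rewrite /GRing.scale /=; ring.
Qed.

Lemma is_derive_barrier (rho : R) (s ds : R -> R) (t dd : R) :
  is_derive t 1 s (ds t) -> is_derive t 1 ds dd ->
  is_derive t 1 (fun t => (rho ^+ 2 - s t) * (3 * rho ^+ 2 - 2 * s t))
    ((4 * s t - 5 * rho ^+ 2) * ds t) /\
  is_derive t 1 (fun t => (4 * s t - 5 * rho ^+ 2) * ds t)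
    (4 * ds t ^+ 2 + (4 * s t - 5 * rho ^+ 2) * dd).
Proof.
by move=> hs hd; split; apply: is_derive_eq; rewrite /GRing.scale /=; ring.
Qed.

Section Barrier.
Variables (V : set (pl R)) (u : pl R -> R) (c : pl R) (rho : R).
Hypotheses (oV : open V) (uC2 : C2_on V u) (Vneg : forall q, V q -> u q < 0).
Hypothesis lapV : forall q, V q ->
  (d1 u q ^+ 2 + d2 u q ^+ 2) * (d1 (d1 u) q + d2 (d2 u) q) = 0.
Hypotheses (rho0 : 0 < rho) (BV : forall q, sqdist c q < rho ^+ 2 -> V q).
Hypothesis ucont : forall q, sqdist c q <= rho ^+ 2 -> {for q, continuous u}.
Hypothesis ule0 : forall q, sqdist c q <= rho ^+ 2 -> u q <= 0.

(* At a maximum of [u + k * barrier] the gradient of [u] cannot vanish, hence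
   [u] is harmonic there. *)
Lemma no_interior_max (k : R) y : 0 < k ->
  3 / 4 * rho ^+ 2 < sqdist c y -> sqdist c y < rho ^+ 2 ->
  ~ (\forall q \near y, u q + k * barrier c rho q <= u y + k * barrier c rho y).
Proof.
move=> k0 sy1 sy2 /= ymax.
have Vy := BV sy2.
have : nbhs y (V `&` [set q | u q + k * barrier c rho q <= u y + k * barrier c rho y]).
  by apply: filterI => //; exact: open_nbhs_nbhs.
move=> /obox_nbhs[r r0 rN].
have inr1 t : `|t - y.1| < r -> cbox (y.1 - r) (y.1 + r) (y.2 - r) (y.2 + r) (t, y.2).
  by rewrite ltr_norml => /andP[? ?]; split; rewrite /= in_itv /=; apply/andP; split; lra.
have inr2 t : `|t - y.2| < r -> cbox (y.1 - r) (y.1 + r) (y.2 - r) (y.2 + r) (y.1, t).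
  by rewrite ltr_norml => /andP[? ?]; split; rewrite /= in_itv /=; apply/andP; split; lra.
have dlin (z t : R) : is_derive t 1 (fun t => 2 * (t - z)) 2.
  by apply: is_derive_eq; rewrite /GRing.scale /=; ring.
have hb1 t := is_derive_barrier rho (is_derive_sqdist1 c y.2 t) (dlin c.1 t).
have hb2 t := is_derive_barrier rho (is_derive_sqdist2 c y.1 t) (dlin c.2 t).
have [_ _ _ [dd11 _ _ dd22] _] := uC2 Vy.
have [D1 L1] : d1 u y + k * ((4 * sqdist c y - 5 * rho ^+ 2) * (2 * (y.1 - c.1))) = 0 /\
    d1 (d1 u) y + k * (4 * (2 * (y.1 - c.1)) ^+ 2 + (4 * sqdist c y - 5 * rho ^+ 2) * 2) <= 0.
  rewrite [in d1 u y](surjective_pairing y) [in sqdist c y](surjective_pairing y).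
  apply: (@local_max_test (fun t => u (t, y.2) + k * barrier c rho (t, y.2))
    (fun t => d1 u (t, y.2) + k * ((4 * sqdist c (t, y.2) - 5 * rho ^+ 2) * (2 * (t - c.1))))
    y.1 _ r r0).
  - move=> t tr; have [Vt _] := rN _ (inr1 t tr).
    have [_ [/derivable_is_d1/is_derive_e1P /= du _] _ _ _] := uC2 Vt.
    have [hb _] := hb1 t.
    by apply: is_deriveD; apply: is_deriveZ.
  - have /is_derive_e1P /= ddu := derivable_is_d1 dd11.
    have [_ hb] := hb1 y.1.
    by apply: is_deriveD; apply: is_deriveZ.
  - by move=> t tr; have [_ /=] := rN _ (inr1 t tr); rewrite -surjective_pairing.
have [D2 L2] : d2 u y + k * ((4 * sqdist c y - 5 * rho ^+ 2) * (2 * (y.2 - c.2))) = 0 /\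
    d2 (d2 u) y + k * (4 * (2 * (y.2 - c.2)) ^+ 2 + (4 * sqdist c y - 5 * rho ^+ 2) * 2) <= 0.
  rewrite [in d2 u y](surjective_pairing y) [in sqdist c y](surjective_pairing y).
  apply: (@local_max_test (fun t => u (y.1, t) + k * barrier c rho (y.1, t))
    (fun t => d2 u (y.1, t) + k * ((4 * sqdist c (y.1, t) - 5 * rho ^+ 2) * (2 * (t - c.2))))
    y.2 _ r r0).
  - move=> t tr; have [Vt _] := rN _ (inr2 t tr).
    have [_ [_ /derivable_is_d2/is_derive_e2P /= du] _ _ _] := uC2 Vt.
    have [hb _] := hb2 t.
    by apply: is_deriveD; apply: is_deriveZ.
  - have /is_derive_e2P /= ddu := derivable_is_d2 dd22.
    have [_ hb] := hb2 y.2.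
    by apply: is_deriveD; apply: is_deriveZ.
  - by move=> t tr; have [_ /=] := rN _ (inr2 t tr); rewrite -surjective_pairing.
have := lapV Vy.
move: (d1 (d1 u) y) (d2 (d2 u) y) L1 L2 => l1 l2 L1 L2.
move: (d1 u y) (d2 u y) D1 D2 => a b D1 D2 /eqP.
have S : sqdist c y = (y.1 - c.1) ^+ 2 + (y.2 - c.2) ^+ 2 by [].
move: (sqdist c y) (y.1 - c.1) (y.2 - c.2) S sy1 sy2 D1 D2 L1 L2 => s X Y S sy1 sy2 D1 D2 L1 L2.
have r2 : 0 < rho ^+ 2 by rewrite exprn_gt0.
move: (rho ^+ 2) r2 sy1 sy2 D1 D2 L1 L2 => r' r2 sy1 sy2 D1 D2 L1 L2.
(* Adding the second-order conditions bounds Lap u by minus [k] times the Laplacian of the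
   barrier. *)
have ln : l1 + l2 < 0.
  have : l1 + l2 + k * (32 * s - 20 * r') <= 0 by rewrite S in L1 L2 *; nra.
  have : 0 < k * (32 * s - 20 * r') by rewrite mulr_gt0//; lra.
  by lra.
rewrite mulf_eq0 (lt_eqF ln) orbF => /eqP ab0.
(* [lapV] has forced a zero gradient, whereas the first-order conditions give it the squared length
   [(2 k (4 s - 5 r'))^2 s], which is nonzero. *)
have aE : a = - (k * ((4 * s - 5 * r') * (2 * X))) by lra.
have bE : b = - (k * ((4 * s - 5 * r') * (2 * Y))) by lra.
have : a ^+ 2 + b ^+ 2 = (k * (4 * s - 5 * r') * 2) ^+ 2 * s.
  by rewrite aE bE S; ring.
rewrite ab0 => /esym/eqP; rewrite mulf_eq0 expf_eq0 /= !mulf_eq0.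
rewrite (gt_eqF k0) /= (lt_eqF (_ : 4 * s - 5 * r' < 0)); last lra.
by rewrite pnatr_eq0 /= (gt_eqF (_ : 0 < s)); last lra.
Qed.

Lemma hopf_annulus : exists2 k : R, 0 < k & forall q,
  3 / 4 * rho ^+ 2 <= sqdist c q <= rho ^+ 2 -> u q <= - (k * (rho ^+ 2 - sqdist c q)).
Proof.
have r2 : 0 < rho ^+ 2 by rewrite exprn_gt0.
have wc (A : set (pl R)) (w : pl R -> R) : (forall q, A q -> {for q, continuous w}) ->
    {within A, continuous w}.
  by move=> h; apply: continuous_in_subspaceT => q /set_mem; exact: h.
(* The closed inner disc, with 3/4 written as a square to fit [compact_annulus]. *)
pose A0 := [set q | 0 <= sqdist c q <= (rho * Num.sqrt (3 / 4)) ^+ 2].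
have sq34 : (rho * Num.sqrt (3 / 4)) ^+ 2 = 3 / 4 * rho ^+ 2 :> R.
  by rewrite exprMn sqr_sqrtr; [ring|rewrite divr_ge0].
have sq0 q : 0 <= sqdist c q by rewrite addr_ge0// sqr_ge0.
have cA0 : compact A0 by exact: compact_annulus.
have [||q0 /set_mem /= q0A q0max] := @compact_EVT_max _ _ u A0 _ cA0.
- by exists c; rewrite /A0 /= sq0 sq34 /sqdist !subrr expr0n /= addr0; nra.
- by apply: wc => q /andP[_]; rewrite sq34 => ?; apply: ucont; lra.
have q0n : u q0 < 0.
  by apply/Vneg/BV; move: q0A => /andP[_]; rewrite sq34 => ?; lra.
(* On the inner circle [u] is at most [u q0] and the barrier equals 3/8 rho^4, so with this [k] the
   sum [w] is at most [5/8 * u q0 < 0] there. *)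
pose k := - u q0 / (rho ^+ 2) ^+ 2.
have k0 : 0 < k by rewrite divr_gt0 ?oppr_gt0 ?exprn_gt0.
have kE : k * (rho ^+ 2) ^+ 2 = - u q0 by rewrite /k divfK// gt_eqF// exprn_gt0.
pose w q := u q + k * barrier c rho q.
pose A := [set q | 3 / 4 * rho ^+ 2 <= sqdist c q <= rho ^+ 2].
have cb q : {for q, continuous (barrier c rho)}.
  rewrite /barrier; apply: cvgM; apply: cvgB; try exact: cvg_cst.
    exact: continuous_sqdist.
  by apply: cvgM; [exact: cvg_cst|exact: continuous_sqdist].
have cw q : sqdist c q <= rho ^+ 2 -> {for q, continuous w}.
  move=> /ucont cu; apply: cvgD; first exact: cu.
  by apply: cvgM; [exact: cvg_cst|exact: cb].
have cA : compact A by exact: compact_annulus.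
have [||y /set_mem /= yA ymax] := @compact_EVT_max _ _ w A _ cA.
- exists (c.1 + rho, c.2); rewrite /A /= /sqdist /= subrr expr0n /= addr0.
  by rewrite (_ : c.1 + rho - c.1 = rho); [apply/andP; split; lra|ring].
- by apply: wc => q /andP[_]; exact: cw.
(* A positive maximum cannot lie on the outer circle, where the barrier vanishes, nor on the inner
   one by the choice of [k], so it would be interior. *)
have wy : w y <= 0.
  rewrite leNgt; apply/negP => wy0.
  move/andP: (yA) => [s1 s2].
  have s2' : sqdist c y < rho ^+ 2.
    rewrite lt_neqAle s2 andbT; apply/eqP => sE.
    by move: wy0; rewrite /w /barrier sE subrr mul0r mulr0 addr0 ltNge ule0// sE.
  have s1' : 3 / 4 * rho ^+ 2 < sqdist c y.
    rewrite lt_neqAle s1 andbT; apply/eqP => sE.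
    have uy : u y <= u q0 by apply: q0max; rewrite inE /A0 /= sq0 sq34 sE lexx.
    move: wy0; rewrite /w /barrier -sE.
    have -> : k * ((rho ^+ 2 - 3 / 4 * rho ^+ 2) * (3 * rho ^+ 2 - 2 * (3 / 4 * rho ^+ 2))) =
      3 / 8 * (k * (rho ^+ 2) ^+ 2) by field.
    by rewrite kE; lra.
  apply: (no_interior_max k0 s1' s2').
  have : nbhs y [set q | 3 / 4 * rho ^+ 2 < sqdist c q < rho ^+ 2].
    have := @continuous_sqdist c y => cs.
    have n1 : nbhs y [set q | 3 / 4 * rho ^+ 2 < sqdist c q].
      by apply: (cvgr_gt _ cs); exact: s1'.
    have n2 : nbhs y [set q | sqdist c q < rho ^+ 2].
      by apply: (cvgr_lt _ cs); exact: s2'.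
    by apply: filterS (filterI n1 n2) => q [/= -> ->].
  apply: filterS => q /= /andP[h1 h2]; apply: ymax.
  by rewrite inE /A /= !ltW.
(* The second factor of the barrier is at least [rho ^+ 2] in the disc, which leaves a bound linear
   in [rho ^+ 2 - sqdist c q]. *)
exists (k * rho ^+ 2); first by rewrite mulr_gt0.
move=> q qA.
have : w q <= 0 by apply: le_trans wy; apply: ymax; rewrite inE.
rewrite /w /barrier; move/andP: qA => [_ h2].
have : 0 <= k * (rho ^+ 2 - sqdist c q) * (2 * (rho ^+ 2 - sqdist c q)).
  by rewrite mulr_ge0// mulr_ge0// ?subr_ge0// ltW.
by move: (sqdist c q) (u q) (rho ^+ 2) => s v r' h h'; lra.
Qed.

Lemma enorm_ge1 (a b : R) : `|a| <= enorm (a, b).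
Proof. by rewrite -sqrtr_sqr /enorm /= ler_wsqrtr// lerDl sqr_ge0. Qed.

Lemma enorm_ge2 (a b : R) : `|b| <= enorm (a, b).
Proof. by rewrite -sqrtr_sqr /enorm /= ler_wsqrtr// lerDr sqr_ge0. Qed.

(** Two estimates of [u] at [pt t t] conflict. The annulus bound gives at most -k rho^2 (2 t - t^2)
    <= -k rho^2 t. Starting from [pt t' t'] close to [x] and moving horizontally, then vertically,
    with partial derivatives at most [de], the value stays above -de M t = -k rho^2 t. *)
Lemma hopf_gradient (x : pl R) : sqdist c x = rho ^+ 2 -> u x = 0 ->
  ~ (enorm (gradm u y) @[y --> x] --> (0 : R)).
Proof.
move=> sx ux gx; have [k k0 hk] := hopf_annulus.
(* [(N1, N2)] points from [x] to the centre. In [M] the 1 pays for the starting value, [|N1|] and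
   [|N2|] for the two legs of the path. *)
pose N1 := c.1 - x.1; pose N2 := c.2 - x.2; pose M := 1 + `|N1| + `|N2|.
have NE : N1 ^+ 2 + N2 ^+ 2 = rho ^+ 2 by rewrite -sx /sqdist /N1 /N2; ring.
have r2 : 0 < rho ^+ 2 by rewrite exprn_gt0.
have M1 : 1 <= M by rewrite /M -addrA lerDl addr_ge0.
have M0 : 0 < M by lra.
pose de := k * rho ^+ 2 / M.
have de0 : 0 < de by rewrite divr_gt0// mulr_gt0.
have deM : de * M = k * rho ^+ 2 by rewrite /de divfK// gt_eqF.
(* Two parameters, because the corner [pt t t'] of the path need not lie on the radius through
   [x]. *)
pose pt (a b : R) : pl R := (x.1 + a * N1, x.2 + b * N2).
have ptbox e T a b : 0 < e -> T * M <= e -> 0 <= a <= T -> 0 <= b <= T ->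
    cbox (x.1 - e) (x.1 + e) (x.2 - e) (x.2 + e) (pt a b).
  move=> e0 TM /andP[a0 aT] /andP[b0 bT].
  have h1 : `|a * N1| <= e.
    rewrite normrM ger0_norm//; apply: le_trans TM; apply: ler_pM => //.
    by rewrite /M; have := normr_ge0 N2; lra.
  have h2 : `|b * N2| <= e.
    rewrite normrM ger0_norm//; apply: le_trans TM; apply: ler_pM => //.
    by rewrite /M; have := normr_ge0 N1; lra.
  move: h1 h2; rewrite !ler_norml => /andP[? ?] /andP[? ?].
  by split; rewrite /= in_itv /=; apply/andP; split; lra.
have ptsq a b : sqdist c (pt a b) = (1 - a) ^+ 2 * N1 ^+ 2 + (1 - b) ^+ 2 * N2 ^+ 2.
  by rewrite /sqdist /pt /N1 /N2 /=; ring.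
have [r r0 rN] : exists2 e : R, 0 < e &
    cbox (x.1 - e) (x.1 + e) (x.2 - e) (x.2 + e) `<=` [set y | enorm (gradm u y) < de].
  by apply: obox_nbhs; apply: (cvgr_lt _ gx).
(* [t <= 1 / 10] keeps [pt t t] in the annulus, since (9/10)^2 >= 3/4; [t <= r / M] keeps the path
   where the gradient is below [de]. *)
pose t := Num.min (1 / 10) (r / M).
have t0 : 0 < t by rewrite lt_min divr_gt0// divr_gt0.
have t10 : t <= 1 / 10 by rewrite ge_min lexx.
have tM : t * M <= r by rewrite -ler_pdivlMr// ge_min lexx orbT.
have [r' r'0 r'N] : exists2 e : R, 0 < e &
    cbox (x.1 - e) (x.1 + e) (x.2 - e) (x.2 + e) `<=` [set y | - (de * t) < u y].
  apply: obox_nbhs; apply: (cvgr_gt _ (ucont (_ : sqdist c x <= rho ^+ 2))); first by rewrite sx.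
  by rewrite ux oppr_lt0 mulr_gt0.
(* The path starts away from [x], since the partial derivatives are available only in {u < 0};
   continuity of [u] at [x] makes the starting value exceed [- (de * t)]. *)
pose t' := Num.min (t / 2) (r' / M).
have t'0 : 0 < t' by rewrite lt_min !divr_gt0.
have t't : t' < t by apply: (@le_lt_trans _ _ (t / 2)); [rewrite ge_min lexx|lra].
have t'M : t' * M <= r' by rewrite -ler_pdivlMr// ge_min lexx orbT.
have low : - (de * t) < u (pt t' t').
  by apply: r'N; apply: (ptbox _ t'); rewrite ?lexx ?(ltW t'0).
have inV a b : t' <= a <= t -> t' <= b <= t ->
    [/\ V (pt a b), `|d1 u (pt a b)| <= de & `|d2 u (pt a b)| <= de].
  move=> /andP[a1 a2] /andP[b1 b2].
  have Vp : V (pt a b).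
    apply: BV; rewrite ptsq.
    have ha : (1 - a) ^+ 2 <= 1 - t' by nra.
    have hb : (1 - b) ^+ 2 <= 1 - t' by nra.
    have := sqr_ge0 N1; have := sqr_ge0 N2 => n2 n1.
    have := ler_wpM2r n1 ha; have := ler_wpM2r n2 hb.
    have : 0 < t' * rho ^+ 2 by rewrite mulr_gt0.
    by rewrite -NE; lra.
  have /= : enorm (gradm u (pt a b)) < de.
    by apply: rN; apply: (ptbox _ t) => //; apply/andP; split; lra.
  rewrite /gradm (Vneg Vp) => /ltW le.
  by split => //; apply: le_trans le; [exact: enorm_ge1|exact: enorm_ge2].
have h't' : t' <= t' <= t by rewrite lexx ltW.
have h'tt : t' <= t <= t by rewrite lexx ltW.
have [z|a /andP[a1 a2] Ea] := @MVT_cc _ (fun a => u (pt a t'))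
    (fun a => d1 u (pt a t') * N1) t' t t't.
  move=> hz; have [Vz _ _] := inV z t' hz h't'.
  have [_ [/derivable_is_d1/is_derive_e1P /= du _] _ _ _] := uC2 Vz.
  have dl : is_derive z 1 (fun z => x.1 + z * N1) N1.
    by apply: is_derive_eq; rewrite /GRing.scale /=; ring.
  exact: (@is_derive1_comp _ (fun s => u (s, x.2 + t' * N2)) (fun z => x.1 + z * N1)).
have [z|b /andP[b1 b2] Eb] := @MVT_cc _ (fun b => u (pt t b))
    (fun b => d2 u (pt t b) * N2) t' t t't.
  move=> hz; have [Vz _ _] := inV t z h'tt hz.
  have [_ [_ /derivable_is_d2/is_derive_e2P /= du] _ _ _] := uC2 Vz.
  have dl : is_derive z 1 (fun z => x.2 + z * N2) N2.
    by apply: is_derive_eq; rewrite /GRing.scale /=; ring.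
  exact: (@is_derive1_comp _ (fun s => u (x.1 + t * N1, s)) (fun z => x.2 + z * N2)).
have hat : t' <= a <= t by rewrite !ltW.
have hbt : t' <= b <= t by rewrite !ltW.
have [_ g1 _] := inV a t' hat h't'.
have [_ _ g2] := inV t b h'tt hbt.
have bnd (g N : R) : `|g| <= de -> - (de * `|N| * t) <= g * N * (t - t').
  move=> hg; have : `|g * N * (t - t')| <= de * `|N| * t.
    rewrite !normrM [`|t - t'|]ger0_norm; last by rewrite subr_ge0 ltW.
    apply: ler_pM; [exact: mulr_ge0|by rewrite subr_ge0 ltW|exact: ler_wpM2r|].
    by rewrite lerBlDr lerDl ltW.
  by rewrite ler_norml => /andP[].
have := bnd _ N1 g1; have := bnd _ N2 g2; rewrite -Ea -Eb => B2 B1.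
have up : u (pt t t) <= - (k * (rho ^+ 2 * t)).
  have sE : sqdist c (pt t t) = (1 - t) ^+ 2 * rho ^+ 2 by rewrite ptsq -NE; ring.
  apply: le_trans (hk (pt t t) _) _; rewrite sE.
    by apply/andP; split; [apply: ler_wpM2r; nra|nra].
  rewrite lerN2 ler_pM2l//.
  by have := mulr_ge0 (ltW t0) (ltW r2); nra.
have : k * (rho ^+ 2 * t) = de * t + de * `|N1| * t + de * `|N2| * t.
  by rewrite mulrA -deM /M; ring.
by lra.
Qed.

End Barrier.
End Hopf.

(** * Discs above a parabola and propagation of the sign *)

Section InteriorBall.
Context {R : realType}.
Implicit Types (p q x c : pl R) (O : set (pl R)) (u : pl R -> R).

Lemma MVT0 (f df : R -> R) (r s : R) :
  (forall t : R, `|t| < r -> is_derive t 1 f (df t)) -> `|s| < r ->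
  exists2 z, `|z| <= `|s| & f s - f 0 = df z * s.
Proof.
move=> hf sr; have [s0|s0|->] := ltgtP s 0; last first.
- by exists 0; rewrite ?normr0// subrr mulr0.
- have [t|z /andP[z1 z2] E] := @MVT_cc _ f df 0 s s0.
    by move=> /andP[t0 ts]; apply: hf; rewrite ger0_norm// (le_lt_trans ts)// -(gtr0_norm s0).
  by exists z; [rewrite !gtr0_norm// ltW|rewrite E subr0].
- have [t|z /andP[z1 z2] E] := @MVT_cc _ f df s 0 s0.
    move=> /andP[t0 ts]; apply: hf; rewrite ler0_norm//; move: sr; rewrite ltr0_norm//; lra.
  exists z; first by rewrite !ltr0_norm// lerN2 ltW.
  by rewrite -opprB E; ring.
Qed.

(** Hoelder continuity bounds the second derivative near 0, and two mean value steps then give the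
    quadratic remainder. *)
Lemma C2alpha_quadratic (f : R -> R) (r alpha C : R) : 0 < r -> 0 < alpha ->
  (forall s, `|s| < r -> derivable f s 1 /\ derivable (derive1 f) s 1) ->
  (forall s s', `|s| < r -> `|s'| < r ->
    `|derive1 (derive1 f) s - derive1 (derive1 f) s'| <= C * powR `|s - s'| alpha) ->
  f 0 = 0 ->
  exists K, [/\ 0 < K & forall s, `|s| < Num.min r 1 ->
     `|f s - derive1 f 0 * s| <= K * s ^+ 2].
Proof.
have tri (a b c v w : R) : a <= b -> b <= c -> v <= a + w -> v <= w + c + 1 by lra.
move=> r0 al0 df hol f0.
pose f1 := derive1 f; pose f2 := derive1 f1.
(* [|C|] because the sign of [C] is free, and 1 for positivity; arguments below 1 satisfy
   [|t| ^ alpha <= 1]. *)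
pose K := `|f2 0| + `|C| + 1.
have K0 : 0 < K by rewrite ltr_wpDl// addr_ge0.
exists K; split=> // s; rewrite lt_min => /andP[sr s1].
have z0 : `|0 : R| < r by rewrite normr0.
have b2 t : `|t| <= `|s| -> `|f2 t| <= K.
  move=> ts; have h : `|f2 t - f2 0| <= C * `|t| `^ alpha.
    by have := hol t 0 (le_lt_trans ts sr) z0; rewrite subr0.
  have p1 : `|t| `^ alpha <= 1.
    apply: (@le_trans _ _ (1 `^ alpha)); last by rewrite powR1.
    rewrite ge0_ler_powR ?nnegrE ?(ltW al0)//.
    exact: le_trans ts (ltW s1).
  have p0 := powR_ge0 `|t| alpha.
  apply: (tri _ _ _ _ _ h).
    apply: le_trans (ler_norm _) _; rewrite normrM [X in _ * X]ger0_norm//.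
    by rewrite ler_piMr.
  by rewrite -{1}(subrK (f2 0) (f2 t)) ler_normD.
have d1f (t : R) : `|t| < r -> is_derive t 1 f (f1 t).
  by move=> /df[/derivableP h _]; rewrite /f1 derive1E.
have d2f (t : R) : `|t| < r -> is_derive t 1 f1 (f2 t).
  by move=> /df[_ /derivableP h]; rewrite /f2 derive1E.
have d3 (t : R) : `|t| < r -> is_derive t 1 (fun t => f t - f1 0 * t) (f1 t - f1 0).
  move=> /d1f h; apply: is_derive_eq; rewrite /GRing.scale /=; ring.
have [z zs /= E] := MVT0 d3 sr.
rewrite f0 mulr0 !subr0 in E; rewrite E.
have [y yz Ey] := MVT0 d2f (le_lt_trans zs sr).
rewrite Ey !normrM -(real_normK (num_real s)) expr2 -!mulrA.
apply: ler_pM; [exact: normr_ge0|exact: mulr_ge0| |exact: ler_wpM2r].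
by apply: b2; exact: le_trans yz zs.
Qed.

(** The parameters with u < 0 form an open set by continuity, and a closed one because a closure
    point off the boundary is interior; [0, 1] is connected. *)
Lemma neg_segment O u p q : (forall z, O z -> {for z, continuous u}) ->
  (forall t : R, 0 <= t <= 1 ->
     let z := (p.1 + t * (q.1 - p.1), p.2 + t * (q.2 - p.2)) in
     O z /\ ~ bdry [set y | u y < 0] z) ->
  u p < 0 -> u q < 0.
Proof.
move=> cu hz up.
pose g (t : R) : pl R := (p.1 + t * (q.1 - p.1), p.2 + t * (q.2 - p.2)).
have cg : continuous g.
  have cl (a b : R) : continuous (fun t : R => a + t * b).
    by move=> t; apply: cvgD; [exact: cvg_cst|apply: cvgM; [exact: cvg_id|exact: cvg_cst]].
  move=> t P [[A B] [/= Ag Bg] sub].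
  have n1 : nbhs t (fun s => A (g s).1) := cl _ _ t _ Ag.
  have n2 : nbhs t (fun s => B (g s).2) := cl _ _ t _ Bg.
  apply: (@filterS _ _ _ (fun s => A (g s).1 /\ B (g s).2)) (filterI n1 n2) => s.
  by move=> [h1 h2]; apply: (sub (g s)).
pose A : set (pl R) := [set y | u y < 0].
have uI t : 0 <= t <= 1 -> u (g t) < 0 -> interior A (g t).
  by move=> /hz[Oz _] ut; have := cvgr_lt _ (cu _ Oz); apply.
have uC t : 0 <= t <= 1 -> closure A (g t) -> interior A (g t).
  by move=> /hz[_ nb] cl; apply: contrapT => ni; apply: nb.
have := @segment_connected R 0 1 ([set` `[0, 1]%R] `&` [set t | u (g t) < 0]).
have in01 (t : R) : [set` `[0, 1]%R] t -> 0 <= t <= 1 by rewrite /= in_itv.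
have h01 : [set` `[0, 1]%R] (1 : R) by rewrite /= in_itv /= lexx ler01.
have h00 : [set` `[0, 1]%R] (0 : R) by rewrite /= in_itv /= lexx ler01.
move=> H.
have : [set` `[0, 1]%R] `&` [set t | u (g t) < 0] = [set` `[0, 1]%R].
  apply: H.
  - exists 0; split => //=; rewrite /g !mul0r !addr0 -surjective_pairing//.
  - exists (g @^-1` interior A).
      by apply: open_comp; [move=> t _; exact: cg|exact: open_interior].
    apply/seteqP; split => t [h1 h2]; split => //.
      by apply: uI => //; exact: in01.
    exact: (interior_subset h2).
  - exists (g @^-1` closure A).
      by apply: closed_comp; [move=> t _; exact: cg|exact: closed_closure].
    apply/seteqP; split => t [h1 h2]; split => //.
      by apply: subset_closure.
    by apply: (interior_subset (uC _ (in01 _ h1) h2)).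
move=> /seteqP[_ /(_ 1 h01)[_ /=]].
by rewrite /g !mul1r ![_ + (_ - _)]addrC !subrK -surjective_pairing.
Qed.

Section Frame.
Variables (O : set (pl R)) (u : pl R -> R) (x : pl R) (dl K m ta : R).
Hypothesis ucont : forall z, O z -> {for z, continuous u}.
Hypothesis ballO : forall z, sqdist x z < dl ^+ 2 -> O z.
(** The ball will have diameter 2 ta sqrt(1 + m^2): [tadl] keeps it in the disc of radius [dl], and
    [taK] keeps it above the parabola. *)
Hypotheses (dl0 : 0 < dl) (K0 : 0 < K) (ta0 : 0 < ta) (taK : 2 * ta * K < 1).
Hypothesis tadl : 4 * ta ^+ 2 * (1 + m ^+ 2) < dl ^+ 2.

(* In the frame [(A, B)] at [x] the ball reads [A^2 + B^2 < 2 ta (B - m A)]: it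
   is tangent at [x] to the line [B = m A] and lies above the parabola
   [B = m A + K A^2]. *)
Lemma interior_ball_above (cs sn : R) (F : R -> R) y :
  cs ^+ 2 + sn ^+ 2 = 1 ->
  (forall s, `|s| < dl -> `|F s - m * s| <= K * s ^+ 2) ->
  let A z := cs * (z.1 - x.1) + sn * (z.2 - x.2) in
  let B z := - sn * (z.1 - x.1) + cs * (z.2 - x.2) in
  (forall z, sqdist x z < dl ^+ 2 -> bdry [set y | u y < 0] z -> B z = F (A z)) ->
  sqdist x y < dl ^+ 2 -> `|A y| * (`|A y| + 2 * ta * `|m|) < ta ^+ 2 ->
  F (A y) < B y -> u y < 0 ->
  exists c, sqdist c x = ta ^+ 2 * (1 + m ^+ 2) /\
    forall q, sqdist c q <= ta ^+ 2 * (1 + m ^+ 2) ->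
      sqdist x q < dl ^+ 2 /\ (q = x \/ u q < 0).
Proof.
move=> cs1 hF A B hG yd yA yF uy.
pose pnt (a b : R) : pl R := (x.1 + (a * cs - b * sn), x.2 + (a * sn + b * cs)).
have Ap a b : A (pnt a b) = a.
  by rewrite /A /pnt /= -[RHS]mulr1 -cs1; ring.
have Bp a b : B (pnt a b) = b.
  by rewrite /B /pnt /= -[RHS]mulr1 -cs1; ring.
have pntK z : pnt (A z) (B z) = z.
  rewrite [RHS]surjective_pairing /pnt; congr pair.
    by transitivity (x.1 + (cs ^+ 2 + sn ^+ 2) * (z.1 - x.1)); [rewrite /A /B; ring|rewrite cs1; ring].
  by transitivity (x.2 + (cs ^+ 2 + sn ^+ 2) * (z.2 - x.2)); [rewrite /A /B; ring|rewrite cs1; ring].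
pose D z := A z ^+ 2 + B z ^+ 2.
have DE z : sqdist x z = D z.
  transitivity ((cs ^+ 2 + sn ^+ 2) * sqdist x z); first by rewrite cs1 mul1r.
  by rewrite /sqdist /D /A /B; ring.
pose c := pnt (- (ta * m)) ta.
have cE z : sqdist c z = D z - 2 * ta * (B z - m * A z) + ta ^+ 2 * (1 + m ^+ 2).
  transitivity ((A z + ta * m) ^+ 2 + (B z - ta) ^+ 2); last by rewrite /D; ring.
  rewrite -{1}(pntK z) /c /sqdist /pnt /=.
  transitivity ((cs ^+ 2 + sn ^+ 2) * ((A z + ta * m) ^+ 2 + (B z - ta) ^+ 2)); first by ring.
  by rewrite cs1 mul1r.
have D0 z : 0 <= D z by rewrite addr_ge0// sqr_ge0.
(* [G z <= 0] describes the closed ball about [c]. By Cauchy-Schwarz (B - m A)^2 <= (1 + m^2) D, so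
   its points are within one diameter of [x]. *)
pose G z := D z - 2 * ta * (B z - m * A z).
have Gd z : G z <= 0 -> D z < dl ^+ 2.
  move=> Gz; apply: le_lt_trans tadl; rewrite leNgt; apply/negP => hD.
  have cs' : (B z - m * A z) ^+ 2 <= (1 + m ^+ 2) * D z.
    by have := sqr_ge0 (A z + m * B z); rewrite /D; nra.
  move: hD cs' Gz (D0 z); rewrite /G; move: (D z) (B z - m * A z) => e w hD cs' Gz e0.
  have e1 : 0 < e by apply: le_lt_trans hD; rewrite mulr_ge0 ?addr_ge0 ?sqr_ge0// mulr_ge0// sqr_ge0.
  have ew : e <= 2 * ta * w by lra.
  have : e ^+ 2 <= 4 * ta ^+ 2 * w ^+ 2.
    have -> : 4 * ta ^+ 2 * w ^+ 2 = (2 * ta * w) ^+ 2 by ring.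
    by rewrite ler_pXn2r ?nnegrE// (le_trans (ltW e1)).
  have := ler_wpM2l (_ : 0 <= 4 * ta ^+ 2) cs'; rewrite mulr_ge0 ?sqr_ge0// => /(_ isT).
  have := ltr_pM2l e1 (4 * ta ^+ 2 * (1 + m ^+ 2)) e; rewrite hD.
  by move=> h1 h2 h3; move: h1; rewrite expr2 in h3; lra.
have AdA z : D z < dl ^+ 2 -> `|A z| < dl.
  move=> h; rewrite -(@ltr_pXn2r _ 2) ?nnegrE ?(ltW dl0)// real_normK ?num_real//.
  by apply: le_lt_trans h; rewrite /D lerDl sqr_ge0.
have above z : D z < dl ^+ 2 -> K * A z ^+ 2 < B z - m * A z -> F (A z) < B z.
  move=> /AdA/hF; rewrite ler_norml => /andP[_]; lra.
(* In the ball K A^2 <= K D and D <= 2 ta (B - m A); with 2 ta K < 1 the result is strict except at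
   the contact point [x], which the alternative excludes. *)
have Gab z : G z < 0 \/ (G z <= 0 /\ 0 < D z) -> K * A z ^+ 2 < B z - m * A z.
  move=> h.
  have h1 : 2 * ta * K * D z < 2 * ta * (B z - m * A z).
    case: h => [h|[h hD]].
      have : 2 * ta * K * D z <= D z by rewrite ler_piMl// ltW.
      by move: h; rewrite /G; lra.
    have : 2 * ta * K * D z < D z by rewrite gtr_pMl.
    by move: h; rewrite /G; lra.
  have h2 : K * A z ^+ 2 <= K * D z by rewrite ler_pM2l// /D lerDl sqr_ge0.
  by apply: le_lt_trans h2 _; rewrite -(@ltr_pM2l _ (2 * ta)) ?mulr_gt0// mulrA.
have good z : D z < dl ^+ 2 -> F (A z) < B z -> O z /\ ~ bdry [set y | u y < 0] z.
  move=> hD hFB; split; first by apply: ballO; rewrite DE.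
  by move=> /(hG z); rewrite DE => /(_ hD) E; move: hFB; rewrite E ltxx.
(* A relay point with the abscissa of [y] and the height of the centre, in the open ball because
   [|A y|] is small. Negativity passes from [y] to [z0] along a line of constant [A] above the
   graph, then from [z0] to every point of the ball but [x]. *)
pose z0 := pnt (A y) ta.
have Gz0 : G z0 < 0.
  rewrite /G /D /z0 Ap Bp.
  have : m * A y <= `|A y| * `|m|.
    by rewrite -normrM mulrC ler_norm.
  have -> : A y ^+ 2 = `|A y| * `|A y| by rewrite -expr2 real_normK ?num_real.
  move: yA; move: (`|A y| * `|A y|) (`|A y|) => e f h1 h2.
  have : 2 * ta * (m * A y) <= 2 * ta * (f * `|m|) by rewrite ler_pM2l ?mulr_gt0.
  by move: h1; lra.
have uz0 : u z0 < 0.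
  apply: (@neg_segment O u y z0 ucont _ uy) => t /andP[t0 t1] /=.
  set z := (_, _).
  have Az : A z = A y.
    transitivity (A y + t * (A z0 - A y)); first by rewrite /A /z /=; ring.
    by rewrite /z0 Ap subrr mulr0 addr0.
  have Bz : B z = B y + t * (ta - B y).
    transitivity (B y + t * (B z0 - B y)); first by rewrite /B /z /=; ring.
    by rewrite /z0 Bp.
  have Dz0 := Gd _ (ltW Gz0).
  have Dy : D y < dl ^+ 2 by rewrite -DE.
  apply: good.
    rewrite /D Az Bz; move: Dz0 Dy; rewrite /D /z0 Ap Bp.
    have : 0 <= t * (1 - t) * (ta - B y) ^+ 2 by rewrite mulr_ge0 ?sqr_ge0// mulr_ge0// subr_ge0.
    move=> h h1 h2.
    have : (1 - t) * (A y ^+ 2 + B y ^+ 2) + t * (A y ^+ 2 + ta ^+ 2) < dl ^+ 2.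
      have [->|t1'] := eqVneq t 0; first by rewrite subr0 mul1r mul0r addr0.
      have tp : 0 < t by rewrite lt_neqAle eq_sym t1'.
      have a1 : t * (A y ^+ 2 + ta ^+ 2) < t * dl ^+ 2 by rewrite ltr_pM2l.
      have a2 : (1 - t) * (A y ^+ 2 + B y ^+ 2) <= (1 - t) * dl ^+ 2.
        by rewrite ler_wpM2l ?subr_ge0// ltW.
      by lra.
    by apply: le_lt_trans; lra.
  rewrite Az Bz.
  have f1 : F (A y) < ta.
    have := above _ Dz0 (Gab _ (or_introl Gz0)); by rewrite /z0 Ap Bp.
  have [->|t1'] := eqVneq t 0; first by rewrite mul0r addr0.
  have tp : 0 < t by rewrite lt_neqAle eq_sym t1'.
  have a1 : t * F (A y) < t * ta by rewrite ltr_pM2l.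
  have a2 : (1 - t) * F (A y) <= (1 - t) * B y by rewrite ler_wpM2l ?subr_ge0// ltW.
  by lra.
exists c; split.
  by rewrite cE /D /A /B !subrr !mulr0 !addr0 !expr0n /=; ring.
move=> q; rewrite cE => hq.
have Gq : G q <= 0 by rewrite /G; lra.
split; first by rewrite DE; exact: Gd.
have [Dq|Dq] := eqVneq (D q) 0.
  left; move: Dq => /eqP; rewrite /D paddr_eq0 ?sqr_ge0// !expf_eq0 /= => /andP[/eqP a /eqP b].
  by rewrite -(pntK q) a b /pnt !mul0r subr0 addr0 !addr0 -surjective_pairing.
have Dq0 : 0 < D q by rewrite lt_neqAle eq_sym Dq D0.
right; apply: (@neg_segment O u z0 q ucont _ uz0) => t /andP[t0 t1] /=.
set z := (_, _).
have Az : A z = A z0 + t * (A q - A z0) by rewrite /A /z /=; ring.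
have Bz : B z = B z0 + t * (B q - B z0) by rewrite /B /z /=; ring.
(* Convexity of [G]: the segment from [z0] stays strictly inside the ball except possibly at its end
   [q]. *)
have Gz : G z <= (1 - t) * G z0 + t * G q.
  have : 0 <= t * (1 - t) * ((A q - A z0) ^+ 2 + (B q - B z0) ^+ 2).
    by rewrite mulr_ge0 ?addr_ge0 ?sqr_ge0// mulr_ge0// subr_ge0.
  by rewrite /G /D Az Bz; move: (A z0) (B z0) (A q) (B q) => a b a' b'; lra.
have tGq : t * G q <= 0 by rewrite mulr_ge0_le0.
have h : G z < 0 \/ (G z <= 0 /\ 0 < D z).
  have [t1'|t1'] := eqVneq t 1.
    right; have -> : z = q.
      rewrite /z t1' !mul1r [RHS]surjective_pairing; congr pair; ring.
    by [].
  left; apply: le_lt_trans Gz _.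
  have t2 : 0 < 1 - t by rewrite subr_gt0 lt_neqAle t1'.
  have : (1 - t) * G z0 < 0 by rewrite pmulr_rlt0.
  by lra.
have Gz' : G z <= 0 by case: h => [/ltW|[]].
by apply: good; [exact: Gd|apply: above; [exact: Gd|exact: Gab]].
Qed.

End Frame.
End InteriorBall.

(** * From the boundary curve to an interior ball *)

Section CurveBall.
Context {R : realType}.
Implicit Types (p q x c : pl R) (O : set (pl R)) (u : pl R -> R).

Lemma eball_sqdist x (r : R) y : 0 < r -> eball x r y <-> sqdist x y < r ^+ 2.
Proof.
move=> r0; rewrite /eball /enorm /= -/(sqdist x y).
have s0 : 0 <= sqdist x y by rewrite addr_ge0// sqr_ge0.
rewrite -[X in _ <-> _ < X]/(r ^+ 2) -{2}(sqr_sqrtr s0).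
by rewrite ltr_pXn2r ?nnegrE ?sqrtr_ge0 ?ltW.
Qed.

Lemma sqr_lt_norm (a b : R) : 0 < b -> a ^+ 2 < b ^+ 2 -> `|a| < b.
Proof.
by move=> b0; rewrite -(real_normK (num_real a)) ltr_pXn2r ?nnegrE ?(ltW b0).
Qed.

(** A point [y] of {u < 0} near [x] decides the side: by continuity it is not on the boundary, hence
    not on the graph. If it lies below the graph, the frame is turned by the angle pi. *)
Lemma interior_ball_curve O u x (alpha r th : R) (f : R -> R) (C : R) :
  open O -> (forall z, O z -> {for z, continuous u}) ->
  O x -> bdry [set y | u y < 0] x -> 0 < alpha -> 0 < r ->
  (forall s, `|s| < r -> derivable f s 1 /\ derivable (derive1 f) s 1) ->
  (forall s s', `|s| < r -> `|s'| < r ->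
    `|derive1 (derive1 f) s - derive1 (derive1 f) s'| <= C * powR `|s - s'| alpha) ->
  (forall y, eball x r y ->
     ((bdry [set y | u y < 0] `&` O) y <->
        - sin th * (y.1 - x.1) + cos th * (y.2 - x.2)
        = f (cos th * (y.1 - x.1) + sin th * (y.2 - x.2)))) ->
  exists c (rho : R), [/\ 0 < rho, sqdist c x = rho ^+ 2 &
    forall q, sqdist c q <= rho ^+ 2 -> O q /\ (q = x \/ u q < 0)].
Proof.
move=> oO ucont Ox bx al0 r0 df hol hG.
have sxx : sqdist x x = 0 by rewrite /sqdist !subrr expr0n /= addr0.
have f0 : f 0 = 0.
  have xb : eball x r x by apply/eball_sqdist => //; rewrite sxx exprn_gt0.
  by have [+ _] := hG x xb; rewrite !subrr !mulr0 addr0 => /(_ (conj bx Ox)).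
have [K [K0 hK]] := C2alpha_quadratic r0 al0 df hol f0.
have [e e0 eO] := obox_nbhs (open_nbhs_nbhs (conj oO Ox)).
(* [r] for the graph, 1 for the Taylor bound, [e] for staying in [O]. *)
pose dl := Num.min (Num.min r 1) e; pose m := derive1 f 0.
have dl0 : 0 < dl by rewrite !lt_min r0 ltr01 e0.
have dlr : dl <= Num.min r 1 by rewrite /dl ge_min lexx.
have dle : dl <= e by rewrite /dl ge_min lexx orbT.
have dlr' : dl <= r by apply: le_trans dlr _; rewrite ge_min lexx.
have ballO z : sqdist x z < dl ^+ 2 -> O z.
  move=> h; apply: eO.
  have /ltW : `|z.1 - x.1| < dl.
    by apply: sqr_lt_norm => //; apply: le_lt_trans h; rewrite /sqdist lerDl sqr_ge0.
  have /ltW : `|z.2 - x.2| < dl.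
    by apply: sqr_lt_norm => //; apply: le_lt_trans h; rewrite /sqdist lerDr sqr_ge0.
  rewrite !ler_norml => /andP[? ?] /andP[? ?].
  by split; rewrite /= in_itv /=; apply/andP; split; lra.
pose M := `|m|.
have M0 : 0 <= M by exact: normr_ge0.
have mM : m ^+ 2 = M ^+ 2 by rewrite real_normK ?num_real.
have M1 : 0 < 1 + M by lra.
(* The first bound gives 2 ta K <= 1/2; the second gives 2 ta sqrt(1 + m^2) <= 2 ta (1 + M) <= dl /
   2. *)
pose ta := Num.min (1 / (4 * K)) (dl / (4 * (1 + M))).
have ta0 : 0 < ta by rewrite lt_min !divr_gt0// mulr_gt0.
have taK4 : ta * (4 * K) <= 1 by rewrite -ler_pdivlMr ?mulr_gt0// ge_min lexx.
have taM4 : ta * (4 * (1 + M)) <= dl by rewrite -ler_pdivlMr ?mulr_gt0// ge_min lexx orbT.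
have taK : 2 * ta * K < 1 by have := mulr_gt0 ta0 K0; lra.
have tadl : 4 * ta ^+ 2 * (1 + m ^+ 2) < dl ^+ 2.
  have h : (ta * (4 * (1 + M))) ^+ 2 <= dl ^+ 2.
    by rewrite ler_pXn2r ?nnegrE ?(ltW dl0)// !mulr_ge0// ltW.
  rewrite mM; apply: lt_le_trans h.
  have t2 : 0 < ta ^+ 2 by rewrite exprn_gt0.
  have -> : (ta * (4 * (1 + M))) ^+ 2 = ta ^+ 2 * (16 * (1 + M) ^+ 2) by ring.
  have -> : 4 * ta ^+ 2 * (1 + M ^+ 2) = ta ^+ 2 * (4 * (1 + M ^+ 2)) by ring.
  by rewrite ltr_pM2l//; nra.
(* [|A y| < ta / (2 (1 + M))] implies |A y| (|A y| + 2 ta M) < ta^2, which places the relay point in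
   the ball. *)
pose ep := Num.min dl (ta / (2 * (1 + M))).
have ep0 : 0 < ep by rewrite lt_min dl0 divr_gt0// mulr_gt0.
have epdl : ep <= dl by rewrite ge_min lexx.
have epM : ep * (2 * (1 + M)) <= ta by rewrite -ler_pdivlMr ?mulr_gt0// ge_min lexx orbT.
have [y [/= uy yx]] : [set y | u y < 0] `&` [set y | sqdist x y < ep ^+ 2] !=set0.
  apply: bx.1; apply: (cvgr_lt _ (@continuous_sqdist _ x x)).
  by rewrite sxx exprn_gt0.
have yd : sqdist x y < dl ^+ 2.
  by apply: lt_le_trans yx _; rewrite ler_pXn2r ?nnegrE ?(ltW ep0) ?(ltW dl0).
have tr1 : cos th ^+ 2 + sin th ^+ 2 = 1 by exact: cos2Dsin2.
pose A (z : pl R) := cos th * (z.1 - x.1) + sin th * (z.2 - x.2).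
pose B (z : pl R) := - sin th * (z.1 - x.1) + cos th * (z.2 - x.2).
have onG z : sqdist x z < dl ^+ 2 -> bdry [set y | u y < 0] z -> B z = f (A z).
  move=> zd bz; apply/(hG z); last by split => //; exact: ballO.
  apply/eball_sqdist => //; apply: lt_le_trans zd _.
  by rewrite ler_pXn2r ?nnegrE ?(ltW dl0) ?(ltW r0).
have Aep : `|A y| < ep.
  apply: sqr_lt_norm => //; apply: le_lt_trans yx.
  have -> : sqdist x y = A y ^+ 2 + B y ^+ 2.
    transitivity ((cos th ^+ 2 + sin th ^+ 2) * sqdist x y); first by rewrite tr1 mul1r.
    by rewrite /sqdist /A /B; ring.
  by rewrite lerDl sqr_ge0.
have Ay : `|A y| * (`|A y| + 2 * ta * M) < ta ^+ 2.
  have a0 := normr_ge0 (A y).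
  move: Aep a0; move: (`|A y|) => a aep a0.
  have h1 : a * (2 * (1 + M)) < ta by apply: lt_le_trans epM; rewrite ltr_pM2r// mulr_gt0.
  have h2 : a * (2 * (1 + M)) * ta < ta * ta by rewrite ltr_pM2r.
  have h3 : a * a <= a * ta.
    by rewrite ler_wpM2l//; have := mulr_ge0 a0 M0; lra.
  have h4 : 0 <= a * ta by rewrite mulr_ge0// ltW.
  by rewrite expr2; lra.
have nG : B y <> f (A y).
  move=> E.
  have yb : eball x r y.
    apply/eball_sqdist => //; apply: lt_le_trans yd _.
    by rewrite ler_pXn2r ?nnegrE ?(ltW dl0) ?(ltW r0).
  have [[_ ni] Oy] := (hG y yb).2 E; apply: ni.
  by have := cvgr_lt _ (ucont y Oy); apply.
pose rho := ta * Num.sqrt (1 + m ^+ 2).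
have m1 : 0 < 1 + m ^+ 2 by rewrite ltr_pwDl// sqr_ge0.
have rhoE : ta ^+ 2 * (1 + m ^+ 2) = rho ^+ 2 by rewrite /rho exprMn sqr_sqrtr// ltW.
have fin c : sqdist c x = ta ^+ 2 * (1 + m ^+ 2) /\
    (forall q, sqdist c q <= ta ^+ 2 * (1 + m ^+ 2) ->
      sqdist x q < dl ^+ 2 /\ (q = x \/ u q < 0)) ->
    exists c (rho : R), [/\ 0 < rho, sqdist c x = rho ^+ 2 &
      forall q, sqdist c q <= rho ^+ 2 -> O q /\ (q = x \/ u q < 0)].
  rewrite rhoE => -[cx hc]; exists c, rho; split => //.
    by rewrite mulr_gt0// sqrtr_gt0.
  by move=> q /hc[/ballO].
have hf s : `|s| < dl -> `|f s - m * s| <= K * s ^+ 2.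
  by move=> sd; apply: hK; exact: lt_le_trans dlr.
have [lt|gt|/esym/nG//] := ltgtP (f (A y)) (B y).
  have [c hc] := @interior_ball_above _ O u x dl K m ta ucont ballO dl0 K0 ta0 taK tadl
    (cos th) (sin th) f y tr1 hf onG yd Ay lt uy.
  exact: fin hc.
(* Turning by pi negates both frame coordinates and replaces the graph function by [- f (- s)], with
   the same slope [m] and the same remainder bound. *)
have AN z : (- cos th) * (z.1 - x.1) + (- sin th) * (z.2 - x.2) = - A z by rewrite /A; ring.
have BN z : - (- sin th) * (z.1 - x.1) + (- cos th) * (z.2 - x.2) = - B z by rewrite /B; ring.
have tr1' : (- cos th) ^+ 2 + (- sin th) ^+ 2 = 1 by rewrite !sqrrN.
have hf' s : `|s| < dl -> `|- f (- s) - m * s| <= K * s ^+ 2.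
  rewrite -normrN => /hf; rewrite sqrrN -normrN.
  by rewrite (_ : - (f (- s) - m * - s) = - f (- s) - m * s); last ring.
have onG' z : sqdist x z < dl ^+ 2 -> bdry [set y | u y < 0] z ->
    - (- sin th) * (z.1 - x.1) + (- cos th) * (z.2 - x.2) =
    - f (- ((- cos th) * (z.1 - x.1) + (- sin th) * (z.2 - x.2))).
  by move=> zd bz; rewrite AN BN opprK (onG z zd bz).
have Ay' : `|(- cos th) * (y.1 - x.1) + (- sin th) * (y.2 - x.2)| *
    (`|(- cos th) * (y.1 - x.1) + (- sin th) * (y.2 - x.2)| + 2 * ta * `|m|) < ta ^+ 2.
  by rewrite AN normrN.
have lt' : - f (- ((- cos th) * (y.1 - x.1) + (- sin th) * (y.2 - x.2))) <
    - (- sin th) * (y.1 - x.1) + (- cos th) * (y.2 - x.2).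
  by rewrite AN BN opprK ltrN2.
have [c hc] := @interior_ball_above _ O u x dl K m ta ucont ballO dl0 K0 ta0 taK tadl
    (- cos th) (- sin th) (fun s => - f (- s)) y tr1' hf' onG' yd Ay' lt' uy.
exact: fin hc.
Qed.

End CurveBall.

(** * Emptiness of [Sigma] *)

Theorem theorem3p10 (R : realType) (O : set (pl R)) (x20 : R) (u : pl R -> R) :
  open O ->
  weak_solution O x20 u ->
  (forall y : pl R, O y -> x20 <= y.2 -> 0 <= u y) ->
  loc_finite_zero_components O u ->
  (forall x, Sigma O x20 u x ->
     exists r : R, 0 < r /\
       forall y, eball x r y -> O y -> enorm (gradm u y) <= Num.sqrt `|y.2 - x20|) ->
  Sigma O x20 u = set0.
Proof.
move=> oO [g1 [g2 [uW12 ucont uC2 uvar [alpha [/andP[al0 _] curve]]]]] upos _ _.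
rewrite -subset0 => x [Ox bx _ gx _].
have [r [th [f [C [r0 df hol hG]]]]] := curve x Ox (conj bx Ox).
have [c [rho [rho0 cx hball]]] :=
  interior_ball_curve oO ucont Ox bx al0 r0 df hol hG.
pose V := O `&` [set y | u y < 0].
have oV : open V.
  rewrite openE => y [Oy uy]; apply: filterI; first exact: open_nbhs_nbhs.
  by have := cvgr_lt _ (ucont y Oy); apply.
have VC2 : C2_on V u.
  by move=> y [Oy uy]; apply: uC2; split => //=; rewrite lt_eqF.
have Vneg y : V y -> u y < 0 by case.
(* The sign condition above the level puts {u < 0} where the gravity term is a divergence. *)
have Vlow y : V y -> y.2 < x20.
  by move=> [Oy uy]; rewrite ltNge; apply/negP => /(upos y Oy); rewrite leNgt uy.
(* Membership in the closure of {u < 0} excludes [u x > 0], and not being interior excludes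
   [u x < 0]. *)
have ux : u x = 0.
  apply/eqP; rewrite eq_le; apply/andP; split; rewrite leNgt; apply/negP => ux.
    have N : nbhs x [set y | 0 < u y] by have := cvgr_gt _ (ucont x Ox); apply.
    by have [y [/= uy1 uy2]] := bx.1 _ N; move: (lt_trans uy1 uy2); rewrite ltxx.
  by apply: bx.2; have := cvgr_lt _ (ucont x Ox); apply.
apply: (@hopf_gradient R V u c rho oV VC2 Vneg _ rho0 _ _ _ x cx ux gx).
- exact: (@grad_laplacian_eq0 R O V x20 u g1 g2 oO oV (@subIsetl _ _ _) Vneg Vlow VC2 uW12 uvar).
- move=> q qc; have [Oq [qx|uq]] := hball q (ltW qc); last by split.
  by move: qc; rewrite qx cx ltxx.
- by move=> q /hball[/ucont].
- by move=> q /hball[_ [->|/ltW//]]; rewrite ux.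
Qed.
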